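(* Let $KB=(O,M)$ be a tightly coupled probabilistic $\mathcal{EL}^{++}$ ontology (TCP ontology), where $M$ is a Markov logic network, and let $a$ be a ground atom constructed from predicates and individuals in $KB$. The problem of computing the probability $\Pr^{KB}(a)$, given $KB$ and $a$, is $\#P$-hard in the data complexity.
   Context: **$\mathcal{EL}^{++}$.** Concepts are built from pairwise disjoint sets of atomic concept names, role names and individual names $\mathbf I$ by $\top$, $\bot$, nominals $\{a\}$, conjunction $C\sqcap D$, existential restriction $\exists r.C$, and concrete domain concepts $p(f_1,\dots,f_k)$ ($p$ a predicate of a concrete domain $\mathcal D_j$, $f_i$ feature names interpreted as partial functions into the concrete domains, which are pairwise disjoint), with the usual semantics. A TBox is a finite set of general concept inclusions $C\sqsubseteq D$, role inclusions $r_1\circ\cdots\circ r_k\sqsubseteq r$, domain restrictions $dom(r)\sqsubseteq C$ and range restrictions $ran(r)\sqsubseteq C$; an ABox is a finite set of assertions $C(a)$, $r(a,b)$. The standard syntactic restriction of Baader, Brandt and Lutz (2008) on the interplay of role inclusions and range restrictions is assumed: if $r_1\circ\cdots\circ r_k\sqsubseteq s$ with $k\ge 1$ is in the TBox and the TBox imposes $ran(s)\sqsubseteq C$ (directly or through a superrole of $s$), then it also imposes $ran(r_k)\sqsubseteq C$. Axioms and assertions are identified with their first-order translations. **MLNs.** Let $\Delta_{MLN}$ be a finite set of constants, $\mathcal V_{MLN}$ an infinite set of variables, and $\mathcal R_{MLN}$ a finite set of predicate symbols disjoint from the concept and role names. A Markov logic network (MLN) is a finite set $M$ of pairs $(F_j,w_j)$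 with $F_j$ a first-order formula over these symbols and $w_j\in\mathbb R$. The Boolean random variables $X=\{X_1,\dots,X_n\}$ are the ground atoms over $\mathcal R_{MLN}$ and $\Delta_{MLN}$. For a truth assignment $x$ to $X$, $P(X=x)=\frac1Z\exp(\sum_j w_j n_j(x))$, where $n_j(x)$ is the number of ground instances of $F_j$ (over $\Delta_{MLN}$) true in $x$, and $Z=\sum_{x'}\exp(\sum_j w_j n_j(x'))$. **TCP ontologies.** A probabilistic annotation $\lambda$ relative to $M$ is a finite set of pairs $\langle A_i,x_i\rangle$, with $A_i$ an atom over $\mathcal R_{MLN},\mathcal V_{MLN},\Delta_{MLN}$ and $x_i\in\{0,1\}$, such that the atoms of no two distinct pairs are unifiable. If $|\lambda|=|X|$ and all atoms in $\lambda$ are ground, $\lambda$ is a (possible) world (i.e. a truth assignment to $X$); $\Pr_M(\lambda)$ is the probability of this assignment in $M$. A probabilistic $\mathcal{EL}^{++}$ axiom (annotated formula) is $F:\lambda$ with $F$ the first-order translation of an $\mathcal{EL}^{++}$ axiom or assertion and $\lambda$ an annotation; variables may be shared between $F$ and $\lambda$ (and are then instantiated together by a substitution), and constants in annotations may also be individuals of the ontology. A TCP ontology is $KB=(O,M)$ with $O$ a finite set of annotated formulas whose annotations are relative to the MLN $M$. **Semantics.** An interpretation is $\langle D,w\rangle$ with $D$ a database (set of ground atoms over $\mathbf I$ and labeled nulls) and $w$ a world. It satisfies $F:\lambda$ iff, whenever $\theta$ is a most general unifier such that for all $\langle V_i,x_i\rangle\in\lambda$ the atom $\theta V_i$ is a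 random variable to which $w$ assigns the value $x_i$, then $D\models\theta F$. A probabilistic interpretation $Pr$ is a probability distribution over interpretations with finite support; $Pr(F:\lambda)$ is the sum of $Pr(\mathcal I)$ over interpretations $\mathcal I$ satisfying $F:\lambda$. $Pr$ is a model of $KB=(O,M)$ (written $Pr\models KB$) iff (i) $Pr(F:\lambda)=1$ for every $F:\lambda\in O$, and (ii) $1-Pr(\mathit{false}:\lambda)=\Pr_M(\lambda)$ for every world $\lambda$. For a ground atom $a$, $\Pr^{KB}(a)$ is the infimum of $Pr(a:\{\})$ over all probabilistic interpretations $Pr$ with $Pr\models KB$. **Data complexity.** The set of formulas in the MLN and the TBox are considered fixed, while $\mathbf I$ and $\Delta_{MLN}$ (hence the ABox on the ontology side and the set of random variables on the MLN side) are not fixed and are part of the input. *)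

(* Defs.v *)
From HB Require Import structures.
From Stdlib Require Import Relation_Operators List.
From mathcomp Require Import all_boot all_order all_algebra.
From mathcomp Require Import all_classical all_reals all_analysis.
Set Implicit Arguments.
Unset Strict Implicit.
Unset Printing Implicit Defensive.
Import Order.TTheory GRing.Theory Num.Theory.
Local Open Scope ring_scope.

Definition word := seq bool.

(* Names of every sort (variables, constants and individuals, concepts, roles,
   features, predicates) are words.  Sorts of symbols are kept disjoint by the
   syntax; only the individuals and the constants of the Markov logic network
   share one name space, since constants in annotations may be individuals. *)
Definition name := word.

(* inl: variable, inr: constant *)
Definition term := (name + name)%type.
Definition matom := (name * seq term)%type.
Definition gmatom := (name * seq name)%type.

Inductive mform :=
| MAtom of matom
| MNot of mform
| MAnd of mform & mform
| MOr of mform & mform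
| MImp of mform & mform
| MAll of name & mform
| MEx of name & mform.

Definition term_var (t : term) : seq name := if t is inl x then [:: x] else [::].
Definition matom_vars (A : matom) : seq name := flatten [seq term_var t | t <- A.2].

Fixpoint mform_fv (F : mform) : seq name :=
  match F with
  | MAtom A => matom_vars A
  | MNot F1 => mform_fv F1
  | MAnd F1 F2 | MOr F1 F2 | MImp F1 F2 => mform_fv F1 ++ mform_fv F2
  | MAll x F1 | MEx x F1 => [seq y <- mform_fv F1 | y != x]
  end.

(* A signature lists predicate symbols with their arities. *)
Definition signature := seq (name * nat).

Definition wf_term (Delta : seq name) (t : term) : bool :=
  if t is inr c then c \in Delta else true.
Definition wf_matom (sig : signature) (Delta : seq name) (A : matom) : bool :=
  ((A.1, size A.2) \in sig) && all (wf_term Delta) A.2.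
Fixpoint wf_mform (sig : signature) (Delta : seq name) (F : mform) : bool :=
  match F with
  | MAtom A => wf_matom sig Delta A
  | MNot F1 | MAll _ F1 | MEx _ F1 => wf_mform sig Delta F1
  | MAnd F1 F2 | MOr F1 F2 | MImp F1 F2 =>
      wf_mform sig Delta F1 && wf_mform sig Delta F2
  end.

Record mln (R : realType) := MLN {
  mln_sig : signature;
  mln_formulas : seq (mform * R)
}.

Definition wf_mln (R : realType) (M : mln R) (Delta : seq name) : Prop :=
  [/\ uniq (unzip1 (mln_sig M)), NoDup (mln_formulas M) &
      forall p, In p (mln_formulas M) -> wf_mform (mln_sig M) Delta p.1].

Definition ground_matoms (sig : signature) (Delta : seq name) : seq gmatom :=
  flatten [seq [seq (p.1, [seq val c | c <- tval t]) | t : p.2.-tuple (seq_sub Delta)]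
          | p <- sig].

Section Worlds.
Variables (sig : signature) (Delta : seq name).

Definition world := {ffun seq_sub (ground_matoms sig Delta) -> bool}.

(* None if g is not a random variable *)
Definition world_val (w : world) (g : gmatom) : option bool := omap w (insub g).

Definition term_val (e : name -> name) (t : term) : name :=
  match t with inl x => e x | inr c => c end.

Fixpoint mform_true (w : world) (e : name -> name) (F : mform) : bool :=
  match F with
  | MAtom A => world_val w (A.1, [seq term_val e t | t <- A.2]) == Some true
  | MNot F1 => ~~ mform_true w e F1
  | MAnd F1 F2 => mform_true w e F1 && mform_true w e F2
  | MOr F1 F2 => mform_true w e F1 || mform_true w e F2
  | MImp F1 F2 => mform_true w e F1 ==> mform_true w e F2
  | MAll x F1 => all (fun c => mform_true w [eta e with x |-> c] F1) Delta
  | MEx x F1 => has (fun c => mform_true w [eta e with x |-> c] F1) Delta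
  end.

(* The default value [::] is never used: s covers all free variables of F. *)
Definition grounding_env (F : mform) (s : {ffun seq_sub (mform_fv F) -> seq_sub Delta})
  (x : name) : name := if insub x is Some x' then val (s x') else [::].

Definition n_true_groundings (F : mform) (w : world) : nat :=
  #|[set s : {ffun seq_sub (mform_fv F) -> seq_sub Delta}
      | mform_true w (grounding_env s) F]|.

End Worlds.

Definition mln_weight (R : realType) (M : mln R) (Delta : seq name)
    (w : world (mln_sig M) Delta) : R :=
  expR (\sum_(p <- mln_formulas M) p.2 * (n_true_groundings p.1 w)%:R).

Definition mln_prob (R : realType) (M : mln R) (Delta : seq name)
    (w : world (mln_sig M) Delta) : R :=
  mln_weight w / \sum_(w' : world (mln_sig M) Delta) mln_weight w'.

Definition subst := name -> term.
Definition tsubst (theta : subst) (t : term) : term :=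
  match t with inl x => theta x | inr c => inr c end.
Definition asubst (theta : subst) (A : matom) : matom :=
  (A.1, [seq tsubst theta t | t <- A.2]).

Definition unifies (theta : subst) (E : seq (matom * matom)) : Prop :=
  forall p, p \in E -> asubst theta p.1 = asubst theta p.2.
Definition is_mgu (theta : subst) (E : seq (matom * matom)) : Prop :=
  unifies theta E /\
  forall sigma, unifies sigma E ->
    exists tau : subst, forall x, sigma x = tsubst tau (theta x).
Definition unifiable (A B : matom) : Prop := exists theta, unifies theta [:: (A, B)].

Definition annotation := seq (matom * bool).

Definition wf_annotation (sig : signature) (Delta : seq name) (lam : annotation) : Prop :=
  [/\ uniq lam, all (fun p => wf_matom sig Delta p.1) lam &
      forall p q, p \in lam -> q \in lam -> p != q -> ~ unifiable p.1 q.1].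

Definition matom_of_gmatom (g : gmatom) : matom := (g.1, [seq inr c | c <- g.2]).

Definition annotation_of_world (sig : signature) (Delta : seq name)
    (w : world sig Delta) : annotation :=
  [seq (matom_of_gmatom (val g), w g) | g : seq_sub (ground_matoms sig Delta)].

(* theta is a most general unifier of the atoms of lam with random variables
   to which w assigns the annotated truth values. *)
Definition annotation_match (sig : signature) (Delta : seq name) (w : world sig Delta)
    (lam : annotation) (theta : subst) : Prop :=
  (forall p, p \in lam -> exists g : gmatom,
     asubst theta p.1 = matom_of_gmatom g /\ world_val w g = Some p.2) /\
  is_mgu theta [seq (p.1, asubst theta p.1) | p <- lam].

Record concrete_domain := ConcreteDomain {
  cd_carrier : Type;
  cd_pred : pred name;
  cd_arity : name -> nat;
  cd_rel : name -> seq cd_carrier -> Prop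
}.

Record concrete_domains := ConcreteDomains {
  cd_num : nat;
  cd_nth : 'I_cd_num -> concrete_domain
}.

Section ELpp.
Variable CD : concrete_domains.

Inductive concept :=
| CTop
| CBot
| CNominal of name
| CAtom of name
| CAnd of concept & concept
| CEx of name & concept
| CPred of 'I_(cd_num CD) & name & seq name.

(* The TBox axioms carry the variables of their first-order translations
     C(x) -> D(x),
     r1(x0,x1) /\ ... /\ rk(x(k-1),xk) -> r(x0,xk),
     r(x,y) -> C(x),    r(x,y) -> C(y),
   because these variables may be shared with an annotation; RoleIncl x0 rs r
   lists the pairs (ri, xi) in rs. *)
Inductive tbox_axiom :=
| GCI of name & concept & concept
| RoleIncl of name & seq (name * name) & name
| DomRestr of name & name & name & concept
| RanRestr of name & name & name & concept.

Inductive assertion :=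
| CAssert of concept & name
| RAssert of name & name & name.

Inductive formula :=
| FAxiom of tbox_axiom
| FAssertion of assertion
| FFalse.

Definition tbox_axiom_vars (ax : tbox_axiom) : seq name :=
  match ax with
  | GCI x _ _ => [:: x]
  | RoleIncl x rs _ => x :: unzip2 rs
  | DomRestr x y _ _ | RanRestr x y _ _ => [:: x; y]
  end.
Definition formula_vars (F : formula) : seq name :=
  if F is FAxiom ax then tbox_axiom_vars ax else [::].

Fixpoint wf_concept (I : seq name) (C : concept) : bool :=
  match C with
  | CTop | CBot | CAtom _ => true
  | CNominal a => a \in I
  | CAnd C1 C2 => wf_concept I C1 && wf_concept I C2
  | CEx _ C1 => wf_concept I C1
  | CPred j p fs => cd_pred (cd_nth j) p && (size fs == cd_arity (cd_nth j) p)
  end.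
Definition wf_tbox_axiom (I : seq name) (ax : tbox_axiom) : bool :=
  uniq (tbox_axiom_vars ax) &&
  match ax with
  | GCI _ C1 C2 => wf_concept I C1 && wf_concept I C2
  | RoleIncl _ _ _ => true
  | DomRestr _ _ _ C | RanRestr _ _ _ C => wf_concept I C
  end.
Definition wf_assertion (I : seq name) (a : assertion) : bool :=
  match a with
  | CAssert C a => wf_concept I C && (a \in I)
  | RAssert _ a b => (a \in I) && (b \in I)
  end.

Fixpoint concept_names (C : concept) : seq name :=
  match C with
  | CTop | CBot | CNominal _ | CPred _ _ _ => [::]
  | CAtom A => [:: A]
  | CAnd C1 C2 => concept_names C1 ++ concept_names C2
  | CEx _ C1 => concept_names C1
  end.
Fixpoint concept_roles (C : concept) : seq name :=
  match C with
  | CTop | CBot | CNominal _ | CPred _ _ _ | CAtom _ => [::]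
  | CAnd C1 C2 => concept_roles C1 ++ concept_roles C2
  | CEx r C1 => r :: concept_roles C1
  end.
Definition tbox_axiom_concept_names (ax : tbox_axiom) : seq name :=
  match ax with
  | GCI _ C1 C2 => concept_names C1 ++ concept_names C2
  | RoleIncl _ _ _ => [::]
  | DomRestr _ _ _ C | RanRestr _ _ _ C => concept_names C
  end.
Definition tbox_axiom_roles (ax : tbox_axiom) : seq name :=
  match ax with
  | GCI _ C1 C2 => concept_roles C1 ++ concept_roles C2
  | RoleIncl _ rs r => r :: unzip1 rs
  | DomRestr _ _ r C | RanRestr _ _ r C => r :: concept_roles C
  end.
Definition assertion_concept_names (a : assertion) : seq name :=
  if a is CAssert C _ then concept_names C else [::].
Definition assertion_roles (a : assertion) : seq name :=
  match a with CAssert C _ => concept_roles C | RAssert r _ _ => [:: r] end.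

(* The syntactic restriction of Baader, Brandt and Lutz (2008), for k >= 1. *)
Definition direct_subrole (T : seq tbox_axiom) (r s : name) : Prop :=
  exists x y, In (RoleIncl x [:: (r, y)] s) T.
Definition imposes_range (T : seq tbox_axiom) (r : name) (C : concept) : Prop :=
  exists s, clos_refl_trans name (direct_subrole T) r s /\
    exists x y, In (RanRestr x y s C) T.
Definition range_restricted (T : seq tbox_axiom) : Prop :=
  forall x rs rk y s C, In (RoleIncl x (rcons rs (rk, y)) s) T ->
    imposes_range T s C -> imposes_range T rk C.

(* inl: individual, inr: labeled null *)
Definition element := (name + nat)%type.

Definition concrete_value := {j : 'I_(cd_num CD) & cd_carrier (cd_nth j)}.

Inductive fact :=
| ConceptFact of name & element
| RoleFact of name & element & element
| FeatureFact of name & element & concrete_value.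

Definition database := fact -> Prop.

Definition fact_elements (f : fact) : seq element :=
  match f with
  | ConceptFact _ t | FeatureFact _ t _ => [:: t]
  | RoleFact _ t u => [:: t; u]
  end.

(* The universe of a database: the individuals and the nulls occurring in it. *)
Definition universe (I : seq name) (D : database) (t : element) : Prop :=
  match t with
  | inl a => a \in I
  | inr _ => exists f, D f /\ t \in fact_elements f
  end.

(* Atoms are over I and the nulls; features are partial functions. *)
Definition wf_database (I : seq name) (D : database) : Prop :=
  (forall f, D f -> forall a, inl a \in fact_elements f -> a \in I) /\
  (forall g t v1 v2, D (FeatureFact g t v1) -> D (FeatureFact g t v2) -> v1 = v2).

Fixpoint concept_sat (D : database) (C : concept) (t : element) : Prop :=
  match C with
  | CTop => True
  | CBot => False
  | CNominal a => t = inl a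
  | CAtom A => D (ConceptFact A t)
  | CAnd C1 C2 => concept_sat D C1 t /\ concept_sat D C2 t
  | CEx r C1 => exists u, D (RoleFact r t u) /\ concept_sat D C1 u
  | CPred j p fs => exists vs : seq (cd_carrier (cd_nth j)),
      Forall2 (fun f v => D (FeatureFact f t (existT _ j v))) fs vs /\
      cd_rel p vs
  end.

Fixpoint role_chain (D : database) (nu : name -> element) (x : name)
    (rs : seq (name * name)) : Prop :=
  if rs is (r, y) :: rs' then D (RoleFact r (nu x) (nu y)) /\ role_chain D nu y rs'
  else True.

Definition formula_holds (D : database) (nu : name -> element) (F : formula) : Prop :=
  match F with
  | FAxiom (GCI x C1 C2) => concept_sat D C1 (nu x) -> concept_sat D C2 (nu x)
  | FAxiom (RoleIncl x rs r) =>
      role_chain D nu x rs -> D (RoleFact r (nu x) (nu (last x (unzip2 rs))))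
  | FAxiom (DomRestr x y r C) => D (RoleFact r (nu x) (nu y)) -> concept_sat D C (nu x)
  | FAxiom (RanRestr x y r C) => D (RoleFact r (nu x) (nu y)) -> concept_sat D C (nu y)
  | FAssertion (CAssert C a) => concept_sat D C (inl a)
  | FAssertion (RAssert r a b) => D (RoleFact r (inl a) (inl b))
  | FFalse => False
  end.

Definition instantiate (nu : name -> element) (t : term) : element :=
  match t with inl x => nu x | inr c => inl c end.

(* D |= theta F: the variables not instantiated by theta are universally
   quantified over the universe of D.  An instance mapping a variable of F to a
   constant that is not an individual holds vacuously. *)
Definition models_instance (I : seq name) (D : database) (theta : subst) (F : formula) : Prop :=
  forall nu : name -> element,
    (forall x, x \in formula_vars F -> universe I D (instantiate nu (theta x))) ->
    formula_holds D (fun x => instantiate nu (theta x)) F.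

End ELpp.

Arguments CTop {CD}.
Arguments CBot {CD}.
Arguments FFalse {CD}.

Record tcp_ontology (R : realType) (CD : concrete_domains) := TCP {
  kb_tbox : seq (tbox_axiom CD * annotation);
  kb_abox : seq (assertion CD * annotation);
  kb_ind : seq name;      (* the individuals *)
  kb_mln : mln R;
  kb_const : seq name     (* the constants of the Markov logic network *)
}.

Section Semantics.
Variables (R : realType) (CD : concrete_domains) (K : tcp_ontology R CD).

Definition wf_tcp : Prop :=
  [/\ wf_mln (kb_mln K) (kb_const K),
      forall p, In p (kb_tbox K) -> wf_tbox_axiom (kb_ind K) p.1 /\
        wf_annotation (mln_sig (kb_mln K)) (kb_const K) p.2,
      forall p, In p (kb_abox K) -> wf_assertion (kb_ind K) p.1 /\
        wf_annotation (mln_sig (kb_mln K)) (kb_const K) p.2 &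
      range_restricted (unzip1 (kb_tbox K))].

Definition ontology : seq (formula CD * annotation) :=
  [seq (FAxiom p.1, p.2) | p <- kb_tbox K] ++
  [seq (FAssertion p.1, p.2) | p <- kb_abox K].

Record interpretation := Interpretation {
  int_db : database CD;
  int_world : world (mln_sig (kb_mln K)) (kb_const K)
}.

HB.instance Definition _ := gen_eqMixin interpretation.
HB.instance Definition _ := gen_choiceMixin interpretation.

Local Open Scope classical_set_scope.

Definition int_sat (i : interpretation) (F : formula CD) (lam : annotation) : Prop :=
  forall theta, annotation_match (int_world i) lam theta ->
    models_instance (kb_ind K) (int_db i) theta F.

Definition prob_interpretation (P : interpretation -> R) : Prop :=
  [/\ forall i, 0 <= P i,
      finite_set [set i | P i != 0],
      \sum_(i \in [set: interpretation]) P i = 1 &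
      forall i, P i != 0 -> wf_database (kb_ind K) (int_db i)].

Definition prob_of (P : interpretation -> R) (F : formula CD) (lam : annotation) : R :=
  \sum_(i \in [set i | int_sat i F lam]) P i.

Definition is_model (P : interpretation -> R) : Prop :=
  [/\ prob_interpretation P,
      forall p, In p ontology -> prob_of P p.1 p.2 = 1 &
      forall w : world (mln_sig (kb_mln K)) (kb_const K),
        1 - prob_of P FFalse (annotation_of_world w) = mln_prob w].

Definition ground_atom (a : assertion CD) : bool :=
  match a with
  | CAssert (CAtom _) _ | RAssert _ _ _ => true
  | _ => false
  end.

Definition atom_of_tcp (a : assertion CD) : bool :=
  [&& ground_atom a, wf_assertion (kb_ind K) a,
      all (fun A => A \in flatten [seq tbox_axiom_concept_names p.1 | p <- kb_tbox K]
                       ++ flatten [seq assertion_concept_names p.1 | p <- kb_abox K])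
          (assertion_concept_names a)
    & all (fun r => r \in flatten [seq tbox_axiom_roles p.1 | p <- kb_tbox K]
                       ++ flatten [seq assertion_roles p.1 | p <- kb_abox K])
          (assertion_roles a)].

Definition atom_prob (a : assertion CD) : R :=
  inf [set prob_of P (FAssertion a) [::] | P in is_model].

End Semantics.

Inductive move := MLeft | MStay | MRight.

Section Tapes.
Variable G : finType.

(* None is the blank symbol; inr injects the machine's own working symbols. *)
Definition symbol := option (bool + G).

(* A two-way infinite tape: the symbols to the left of the head, nearest first,
   and those from the head rightwards; all other cells are blank. *)
Definition tape := (seq symbol * seq symbol)%type.

Definition tape_read (t : tape) : symbol := head None t.2.
Definition tape_write (s : symbol) (t : tape) : tape := (t.1, s :: behead t.2).
Definition tape_move (m : move) (t : tape) : tape :=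
  match m with
  | MLeft => (behead t.1, head None t.1 :: t.2)
  | MStay => t
  | MRight => (tape_read t :: t.1, behead t.2)
  end.

Definition tape_of_word (u : word) : tape := ([::], [seq Some (inl b) | b <- u]).

(* The longest word of bits starting at the head. *)
Fixpoint read_bits (s : seq symbol) : word :=
  if s is Some (inl b) :: s' then b :: read_bits s' else [::].
Definition word_of_tape (t : tape) : word := read_bits t.2.

End Tapes.

(* Deterministic Turing machines with k tapes; tm_delta halts on None. *)
Record tm (k : nat) := TM {
  tm_state : finType;
  tm_work : finType;
  tm_start : tm_state;
  tm_accept : pred tm_state;
  tm_delta : tm_state -> {ffun 'I_k -> symbol tm_work} ->
    option (tm_state * {ffun 'I_k -> symbol tm_work * move})
}.

Definition config (k : nat) (M : tm k) :=
  (tm_state M * {ffun 'I_k -> tape (tm_work M)})%type.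

Definition tm_step (k : nat) (M : tm k) (c : config M) : option (config M) :=
  if tm_delta c.1 [ffun i => tape_read (c.2 i)] is Some (q, act) then
    Some (q, [ffun i => tape_move (act i).2 (tape_write (act i).1 (c.2 i))])
  else None.

(* A halted configuration is a fixed point of run. *)
Definition run (C : Type) (step : C -> option C) (n : nat) (c : C) : C :=
  iter n (fun c => odflt c (step c)) c.
Definition halted (C : Type) (step : C -> option C) (c : C) : Prop := step c = None.

Definition poly_bound (p : {poly nat}) (n : nat) : nat := p.[n].

Definition start_config (M : tm 1) (u : word) : config M :=
  (tm_start M, [ffun => tape_of_word _ u]).
Definition halts_within (M : tm 1) (u : word) (n : nat) : Prop :=
  halted (@tm_step 1 M) (run (@tm_step 1 M) n (start_config M u)).
Definition accepts_within (M : tm 1) (u : word) (n : nat) : bool :=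
  tm_accept (run (@tm_step 1 M) n (start_config M u)).1.

Definition pair_words (x y : word) : word :=
  flatten [seq [:: b; b] | b <- x] ++ [:: false; true] ++ y.

(* f(x) is the number of witnesses of length q(|x|) accepted together with x by a
   polynomial-time machine. *)
Definition sharpP (f : word -> nat) : Prop :=
  exists (V : tm 1) (p q : {poly nat}),
    (forall u, halts_within V u (poly_bound p (size u))) /\
    forall x, f x = #|[set y : (poly_bound q (size x)).-tuple bool
      | accepts_within V (pair_words x y) (poly_bound p (size (pair_words x y)))]|.

(* Oracle machines: tape 0 is the input/output tape and tape 1 the oracle tape.
   In a state q with otm_ask q = Some q' the word at the head of tape 1 is
   replaced, in one step, by the answer of the oracle, and q' is entered. *)
Record oracle_tm := OracleTM {
  otm_tapes : nat;
  otm_tm :> tm otm_tapes.+2;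
  otm_ask : tm_state otm_tm -> option (tm_state otm_tm)
}.

Definition input_tape (k : nat) : 'I_k.+2 := ord0.
Definition oracle_tape (k : nat) : 'I_k.+2 := lift ord0 ord0.

Definition oracle_step (N : oracle_tm) (O : word -> word) (c : config N) :
    option (config N) :=
  if otm_ask c.1 is Some q then
    Some (q, [ffun i => if i == oracle_tape (otm_tapes N)
                        then tape_of_word _ (O (word_of_tape (c.2 i))) else c.2 i])
  else tm_step c.

Definition oracle_start (N : oracle_tm) (u : word) : config N :=
  (tm_start N, [ffun i => tape_of_word _ (if i == input_tape (otm_tapes N) then u else [::])]).

(* Most significant bit first. *)
Definition nat_of_word (u : word) : nat := foldl (fun n (b : bool) => n.*2 + b)%N 0%N u.

Definition oracle_computes_within (N : oracle_tm) (O : word -> word) (x : word) (t v : nat) :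
    Prop :=
  let c := run (oracle_step O) t (oracle_start N x) in
  halted (@oracle_step N O) c /\
  nat_of_word (word_of_tape (c.2 (input_tape (otm_tapes N)))) = v.

(* solves O says that the oracle O solves the problem in question.  The problem is
   #P-hard if every function in #P is polynomial-time Turing reducible to it. *)
Definition sharpP_hard (solves : (word -> word) -> Prop) : Prop :=
  forall f, sharpP f ->
    exists (N : oracle_tm) (p : {poly nat}),
      forall O, solves O -> forall x, oracle_computes_within N O x (poly_bound p (size x)) (f x).

Definition enc_nat (n : nat) : word := rcons (nseq n true) false.
Definition enc_seq (T : Type) (e : T -> word) (s : seq T) : word :=
  flatten [seq true :: e x | x <- s] ++ [:: false].
Definition enc_name : name -> word := enc_seq (fun b => [:: b]).
Definition enc_term (t : term) : word :=
  match t with inl x => false :: enc_name x | inr c => true :: enc_name c end.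
Definition enc_matom (A : matom) : word := enc_name A.1 ++ enc_seq enc_term A.2.
Definition enc_annotation : annotation -> word :=
  enc_seq (fun p : matom * bool => p.2 :: enc_matom p.1).

Fixpoint enc_concept (CD : concrete_domains) (C : concept CD) : word :=
  match C with
  | CTop => enc_nat 0
  | CBot => enc_nat 1
  | CNominal a => enc_nat 2 ++ enc_name a
  | CAtom A => enc_nat 3 ++ enc_name A
  | CAnd C1 C2 => enc_nat 4 ++ enc_concept C1 ++ enc_concept C2
  | CEx r C1 => enc_nat 5 ++ enc_name r ++ enc_concept C1
  | CPred j p fs => enc_nat 6 ++ enc_nat j ++ enc_name p ++ enc_seq enc_name fs
  end.
Definition enc_assertion (CD : concrete_domains) (a : assertion CD) : word :=
  match a with
  | CAssert C a => false :: enc_concept C ++ enc_name a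
  | RAssert r a b => true :: enc_name r ++ enc_name a ++ enc_name b
  end.

(* In data complexity the TBox, with its annotations, and the weighted formulas of
   the Markov logic network are fixed; the rest is the input.  The encodings enc_*
   of its components are prefix-free. *)
Record data_input (CD : concrete_domains) := DataInput {
  di_ind : seq name;
  di_const : seq name;
  di_abox : seq (assertion CD * annotation);
  di_atom : assertion CD
}.

Definition enc_input (CD : concrete_domains) (d : data_input CD) : word :=
  enc_seq enc_name (di_ind d) ++ enc_seq enc_name (di_const d) ++
  enc_seq (fun p : assertion CD * annotation => enc_assertion p.1 ++ enc_annotation p.2)
    (di_abox d) ++
  enc_assertion (di_atom d).

Definition tcp_of_input (R : realType) (CD : concrete_domains)
    (T : seq (tbox_axiom CD * annotation)) (M : mln R) (d : data_input CD) :
    tcp_ontology R CD :=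
  TCP T (di_abox d) (di_ind d) M (di_const d).

(* The infimum defining the probability is over a nonempty set only if the
   ontology has a model. *)
Definition valid_input (R : realType) (CD : concrete_domains)
    (T : seq (tbox_axiom CD * annotation)) (M : mln R) (d : data_input CD) : Prop :=
  [/\ wf_tcp (tcp_of_input T M d), atom_of_tcp (tcp_of_input T M d) (di_atom d) &
      exists P, is_model (K := tcp_of_input T M d) P].

(* The probability is a real number, so that computing it means computing it to
   any requested precision: on an input d and a number k given in unary the answer
   is the (k+1)-bit binary numeral of an m with |m / 2^k - Pr(a)| <= 2^-k. *)
Definition computes_prob (R : realType) (CD : concrete_domains)
    (T : seq (tbox_axiom CD * annotation)) (M : mln R) (O : word -> word) : Prop :=
  forall d, valid_input T M d -> forall k,
    let u := O (enc_input d ++ enc_nat k) in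
    size u = k.+1 /\
    `|(nat_of_word u)%:R / 2 ^+ k - atom_prob (tcp_of_input T M d) (di_atom d)|
      <= 2 ^- k :> R.

(* Main.v *)
Require Import Defs.
From HB Require Import structures.
From mathcomp Require Import all_boot all_order all_algebra.
From mathcomp Require Import all_classical all_reals all_analysis.
From mathcomp Require Import zify ring.
Set Implicit Arguments.
Unset Strict Implicit.
Unset Printing Implicit Defensive.
Import Order.TTheory GRing.Theory Num.Theory.

(** With an empty TBox and a Markov logic network consisting of one unary
    predicate and no formula, all worlds are equally likely, and an ABox of
    assertions A(a) : t_i, for terms t_i over the random variables, makes
    Pr(A(a)) the fraction of worlds that satisfy the disjunction of the t_i.
    A counting problem given by a verifier V is therefore solved by one query:
    the t_i are the violated local constraints of the Cook-Levin tableau of V,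
    so that the worlds satisfying none of them are in bijection with the accepted
    witnesses.  If K is the number of random variables, precision K + 2
    determines the count.  The reduction is carried out by an oracle Turing
    machine compiled from a small language of stack programs, and its running
    time is bounded by a logic of triples with an implicit polynomial bound. *)

(** * Disjunctive normal forms as ABoxes *)

Local Open Scope ring_scope.
Local Open Scope classical_set_scope.

(** The TBox and the Markov logic network are fixed, so an instance can live only in the ABox and in
    the number of constants. An assertion annotated by a term t is the implication from t to A(a):
    every model gives A(a) at least the mass of the worlds satisfying some term, and a model with a
    least database over each world attains this bound. Several assertions therefore express a
    disjunction of conjunctions and nothing else, which is why the constraints of the tableau enter
    negatively, as violations, and why the oracle approximates (2^K - f) / 2^K rather than f / 2^K.

    Every variable other than the witness bits has to be determined, because one unconstrained
    variable would double the count. All terms are shifted copies of finitely many templates that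
    depend on V alone; the machine that writes them only needs unary counters for the base of a cell
    and for the distance to the cell below.

    Precision K + 2 turns the answer into an integer m with |m - 4 (2^K - f)| <= 1, so that rounding
    m / 4 recovers f. *)

Definition unary_sig : signature := [:: ([::], 1%N)].
Definition uniform_mln (R : realType) : mln R := MLN unary_sig [::].
(* The constants are the unary numerals, so that variable v is the atom of 1^v. *)
Definition cname (v : nat) : name := nseq v true.
Definition gatom (v : nat) : gmatom := ([::], [:: cname v]).
Definition literal := (nat * bool)%type.
Definition ann (t : seq literal) : annotation :=
  [seq (matom_of_gmatom (gatom l.1), l.2) | l <- t].
Definition consts (K : nat) : seq name := [seq cname v | v <- iota 0 K].
Definition goal (CD : concrete_domains) : assertion CD := CAssert (CAtom CD [::]) [::].
Definition dnf_input (CD : concrete_domains) (K : nat) (F : seq (seq literal)) : data_input CD :=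
  DataInput [:: [::]] (consts K) [seq (goal CD, ann t) | t <- F] (goal CD).

Definition wf_dnf (K : nat) (F : seq (seq literal)) : bool :=
  (F != [::]) && all (fun t => uniq (unzip1 t) && all (fun l => l.1 < K)%N t) F.

Definition bits (sig : signature) (Delta : seq name) (w : world sig Delta) (v : nat) : bool :=
  world_val w (gatom v) == Some true.
Definition sat_term (w : nat -> bool) (t : seq literal) : bool :=
  all (fun l => w l.1 == l.2) t.
Definition sat_dnf (w : nat -> bool) (F : seq (seq literal)) : bool := has (sat_term w) F.

Lemma matom_of_gmatom_inj : injective matom_of_gmatom.
Proof.
move=> [p s] [p' s'] [-> /inj_map] H; congr (_, _); apply: H.
by move=> x y [].
Qed.

Lemma asubst_ground theta g : asubst theta (matom_of_gmatom g) = matom_of_gmatom g.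
Proof. by rewrite /asubst /matom_of_gmatom /= -map_comp; congr (_, _); apply: eq_map. Qed.

Lemma In_mem (T : eqType) (x : T) s : List.In x s -> x \in s.
Proof. by elim: s => //= y s IH [->|/IH]; rewrite inE ?eqxx // => ->; rewrite orbT. Qed.

Lemma List_In_mem (T : eqType) (x : T) s : x \in s -> List.In x s.
Proof. by elim: s => //= y s IH; rewrite inE => /orP[/eqP->|/IH]; [left|right]. Qed.

Section GroundMatch.
Variables (sig : signature) (Delta : seq name) (w : world sig Delta).
Variable lam : seq (gmatom * bool).
Let glam : annotation := [seq (matom_of_gmatom p.1, p.2) | p <- lam].

(** Substitutions fix ground atoms, so a match depends on the world alone and not on [theta]. *)
Lemma ground_match_val theta : annotation_match w glam theta ->
  forall p, p \in lam -> world_val w p.1 = Some p.2.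
Proof.
move=> [H _] p pl.
have [|g [Hg Hw]] := H (matom_of_gmatom p.1, p.2); first exact/map_f.
by move: Hg; rewrite asubst_ground => /matom_of_gmatom_inj ->.
Qed.

(** The equations to be unified are trivial, and the identity substitution [inl] is most general
    because every [sigma] factors through it as itself. *)
Lemma ground_match : (forall p, p \in lam -> world_val w p.1 = Some p.2) ->
  annotation_match w glam inl.
Proof.
move=> H; split.
  move=> _ /mapP[p pl ->]; exists p.1; rewrite asubst_ground; split => //.
  exact: H.
split; last by move=> sigma _; exists sigma.
move=> _ /mapP[_ /mapP[p pl ->] ->] /=.
by rewrite !asubst_ground.
Qed.
End GroundMatch.

Lemma cname_inj : injective cname.
Proof. by move=> u v /(congr1 size); rewrite !size_nseq. Qed.

Lemma gatom_inj : injective gatom.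
Proof. by move=> u v [/cname_inj]. Qed.

Lemma mem_consts K v : (cname v \in consts K) = (v < K)%N.
Proof. by rewrite (mem_map cname_inj) mem_iota. Qed.

Lemma ground_matomsE K : ground_matoms unary_sig (consts K) =i [seq gatom v | v <- iota 0 K].
Proof.
move=> g; rewrite /ground_matoms /= cats0; apply/mapP/mapP.
  move=> [t _ ->]; have [v vK cE] : exists2 v, (v < K)%N & val (tnth t ord0) = cname v.
    by have /mapP[v] := valP (tnth t ord0); rewrite mem_iota => vK ->; exists v.
  exists v; first by rewrite mem_iota.
  by rewrite /gatom -cE; case: t {cE} => -[|x []].
move=> [v]; rewrite mem_iota /= => vK ->.
have cv : cname v \in consts K by rewrite mem_consts.
by exists [tuple SeqSub cv]; rewrite ?mem_enum.
Qed.

Lemma gatom_ground K v : (gatom v \in ground_matoms unary_sig (consts K)) = (v < K)%N.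
Proof. by rewrite ground_matomsE (mem_map gatom_inj) mem_iota. Qed.

Lemma card_gatoms K : #|{: seq_sub (ground_matoms unary_sig (consts K))}| = K.
Proof.
rewrite card_seq_sub.
  rewrite (perm_size (uniq_perm _ _ (ground_matomsE K))) ?size_map ?size_iota //.
    rewrite /ground_matoms /= cats0 map_inj_uniq ?enum_uniq // => t t' [] H.
    by apply/val_inj; apply: (inj_map val_inj).
  by rewrite (map_inj_uniq gatom_inj) iota_uniq.
rewrite /ground_matoms /= cats0 map_inj_uniq ?enum_uniq // => t t' [] H.
by apply/val_inj; apply: (inj_map val_inj).
Qed.

Lemma bitsE K (w : world unary_sig (consts K)) v (b : bool) : (v < K)%N ->
  (world_val w (gatom v) = Some b) <-> (bits w v = b).
Proof.
move=> vK; rewrite /bits /world_val insubT ?gatom_ground //= => ?.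
by case: (w _); case: b; split.
Qed.

(** Replaces a sum over a set of interpretations by a sum over a list containing the support, where
    [bigID] and [partition_big] apply. *)
Lemma fsum_seq (T : choiceType) (R : numDomainType) (s : seq T) (A : set T) (P : T -> R) :
  uniq s -> (forall i, P i != 0 -> i \in s) ->
  \sum_(i \in A) P i = \sum_(i <- s | i \in A) P i.
Proof.
move=> us sP; rewrite -[RHS]big_filter.
have <- : \sum_(i \in A `&` [set` s]) P i = \sum_(i \in A) P i.
  apply: fsbig_widen; first by move=> i [].
  move=> i [Ai] /= nA; apply/eqP; apply: contra_notT nA => Pi0.
  by split => //; exact: sP.
apply: fsbig_fwiden; last by move=> i [] /=; rewrite mem_filter => /andP[/set_mem Ai si] [].
  by move=> i [Ai si] /=; rewrite mem_filter si mem_set.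
exact: filter_uniq.
Qed.

Section DnfProb.
Variables (R : realType) (CD : concrete_domains) (K : nat) (F : seq (seq literal)).
Hypothesis wfF : wf_dnf K F.
Let d := dnf_input CD K F.
Let KB : tcp_ontology R CD := tcp_of_input [::] (uniform_mln R) d.
Let W := world unary_sig (consts K).

Lemma ann_match_sat (w : W) t theta : t \in F ->
  annotation_match w (ann t) theta -> sat_term (bits w) t.
Proof.
move=> tF; have /andP[_ /allP/(_ _ tF)/andP[ut /allP tK]] := wfF.
rewrite (_ : ann t = [seq (matom_of_gmatom p.1, p.2) | p <- [seq (gatom l.1, l.2) | l <- t]]).
  move=> /ground_match_val H; apply/allP => l lt; apply/eqP.
  apply/bitsE; first exact: tK.
  by apply: (H (gatom l.1, l.2)); apply/mapP; exists l.
by rewrite -map_comp.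
Qed.

Lemma sat_ann_match (w : W) t : t \in F ->
  sat_term (bits w) t -> annotation_match w (ann t) inl.
Proof.
move=> tF; have /andP[_ /allP/(_ _ tF)/andP[ut /allP tK]] := wfF.
rewrite (_ : ann t = [seq (matom_of_gmatom p.1, p.2) | p <- [seq (gatom l.1, l.2) | l <- t]]).
  move=> /allP H; apply: ground_match => _ /mapP[l lt ->] /=.
  by apply: (proj2 (bitsE _ _ (tK _ lt))); exact: (eqP (H _ lt)).
by rewrite -map_comp.
Qed.

Lemma dnf_wf_tcp : wf_tcp KB.
Proof.
split => //.
  by split => //; constructor.
move=> p /List.in_map_iff [t [<- /In_mem tF]].
have /andP[_ /allP/(_ _ tF)/andP[ut /allP tK]] := wfF.
split => //; split.
- apply: (@map_uniq _ _ (fun p : matom * bool => p.1)).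
  rewrite -map_comp (map_comp (matom_of_gmatom \o gatom) fst) map_inj_uniq //.
  by move=> x y /matom_of_gmatom_inj/gatom_inj.
- apply/allP => _ /mapP[l lt ->].
  by rewrite /wf_matom /= mem_consts tK.
- move=> _ _ /mapP[l lt ->] /mapP[l' lt' ->] ne [theta /(_ _ (mem_head _ _))] /=.
  rewrite !asubst_ground => /matom_of_gmatom_inj/gatom_inj E.
  case/eqP: ne; congr (_, _); first by rewrite E.
  have /(nth_uniq 0%N) H := ut.
  have := H (index l t) (index l' t); rewrite /unzip1 !size_map !index_mem lt lt'.
  rewrite !(nth_map l) ?index_mem // !nth_index // E eqxx => /(_ isT isT)/esym/eqP {}H.
  by rewrite -(nth_index l lt) H nth_index.
Qed.

Lemma dnf_atom_of_tcp : atom_of_tcp KB (goal CD).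
Proof.
rewrite /atom_of_tcp /=; have /andP[] := wfF.
by case: F => [|t s] // _ _; rewrite /= !andbT !inE eqxx.
Qed.

Lemma mln_probE (w : W) : mln_prob (M := uniform_mln R) w = 2 ^- K.
Proof.
rewrite /mln_prob /mln_weight big_nil expR0 div1r; congr (_^-1).
rewrite (eq_bigr (fun=> 1)) => [|w' _]; last by rewrite big_nil expR0.
rewrite sumr_const card_ffun card_bool.
rewrite (_ : #|_| = K) ?natrX //; exact: card_gatoms.
Qed.

Let I := interpretation KB.

(** Only [w] matches its own annotation, and a match makes [FFalse] fail; thus one minus the
    probability of this formula is the mass of [w]. *)
Lemma sat_false_world (i : I) (w : W) :
  int_sat i FFalse (annotation_of_world w) <-> int_world i <> w.
Proof.
have awE : annotation_of_world w = [seq (matom_of_gmatom p.1, p.2) |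
    p <- [seq (val g, w g) | g : seq_sub (ground_matoms unary_sig (consts K))]].
  by rewrite /annotation_of_world -map_comp.
split.
  (* [FFalse] has no variables, so the valuation is arbitrary. *)
  move=> H E; apply: (H inl _ (fun=> inl [::])) => //.
  rewrite awE; apply: ground_match => _ /mapP[g _ ->] /=.
  by rewrite /world_val E valK.
move=> ne theta; rewrite awE => /ground_match_val H; case: ne.
apply/ffunP => g.
have := H (val g, w g); rewrite (map_f (fun g => (val g, w g))) ?mem_enum // => /(_ isT).
by rewrite /world_val valK => -[].
Qed.

Lemma sat_goal (i : I) :
  int_sat i (FAssertion (goal CD)) [::] <-> int_db i (ConceptFact CD [::] (inl [::])).
Proof.
split; last by move=> H theta _ nu _.
move=> H; apply: (H inl _ (fun=> inl [::])) => //.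
by apply: (@ground_match _ _ _ [::]).
Qed.

Lemma sat_goal_ann (i : I) t : t \in F ->
  int_sat i (FAssertion (goal CD)) (ann t) <->
  (sat_term (bits (int_world i)) t -> int_db i (ConceptFact CD [::] (inl [::]))).
Proof.
move=> tF; split.
  by move=> H /(sat_ann_match tF) m; apply: (H inl m (fun=> inl [::])).
by move=> H theta /(ann_match_sat tF) m nu _; exact: H.
Qed.

Definition n_sat : nat := #|[set w : W | sat_dnf (bits w) F]%SET|.

Lemma n_satE : n_sat%:R / 2 ^+ K = \sum_(w : W | sat_dnf (bits w) F) 2 ^- K :> R.
Proof.
rewrite sumr_const -[RHS]mulr_natl; congr (_%:R * _).
by apply: eq_card => w; rewrite inE.
Qed.

(** The condition on worlds gives each world mass 2^-K. An assertion of probability 1 holds at every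
    interpretation of the finite support, so wherever some term is true the goal is in the
    database. *)
Lemma dnf_prob_ge (P : I -> R) : is_model P ->
  n_sat%:R / 2 ^+ K <= prob_of P (FAssertion (goal CD)) [::].
Proof.
move=> [[P0 finP P1 _] ontP worldP].
pose s : seq I := finmap.enum_fset (fset_set [set i | P i != 0]).
have us : uniq s by exact: finmap.fset_uniq.
have sP i : P i != 0 -> i \in s by move=> Pi; rewrite /s in_fset_set // mem_set.
have Ps i : i \in s -> P i != 0 by rewrite /s in_fset_set // => /set_mem.
have sumT : \sum_(i <- s) P i = 1.
  rewrite -P1 (fsum_seq _ us sP); apply: eq_bigl => i.
  by rewrite mem_set.
have sat t i : t \in F -> i \in s -> int_sat i (FAssertion (goal CD)) (ann t).
  move=> tF si; apply: contrapT => nsat.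
  have : prob_of P (FAssertion (goal CD)) (ann t) = 1.
    apply: (ontP (FAssertion (goal CD), ann t)).
    rewrite /ontology /= -map_comp; apply/List.in_map_iff; exists t; split => //.
    exact/List_In_mem.
  rewrite /prob_of (fsum_seq _ us sP) -sumT -[LHS]addr0.
  rewrite [RHS](bigID (fun i => i \in [set i | int_sat i (FAssertion (goal CD)) (ann t)])) /=.
  (* The interpretations violating the assertion have total mass 0, hence each of them has mass 0,
     against [i] being in the support. *)
  move=> /addrI/esym/eqP; rewrite psumr_eq0 // => /allP/(_ _ si).
  rewrite (negbTE (Ps _ si)) implybF negbK => /set_mem; exact: nsat.
have worldE (w : W) : \sum_(i <- s | int_world i == w) P i = 2 ^- K.
  rewrite -(mln_probE w) -worldP /prob_of (fsum_seq _ us sP) -sumT.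
  rewrite [X in _ = X - _](bigID (fun i => i \in [set i | int_sat i FFalse (annotation_of_world w)])) /=.
  rewrite addrC addrK; apply: eq_bigl => i.
  apply/eqP/idP => [E|]; first by apply/negP => /set_mem/sat_false_world; apply.
  by move=> H; apply: contrapT => /sat_false_world ne; rewrite mem_set in H.
rewrite n_satE (eq_bigr _ (fun w _ => esym (worldE w))).
rewrite /prob_of (fsum_seq _ us sP).
rewrite [leLHS](_ : _ = \sum_(i <- s | sat_dnf (bits (int_world i)) F) P i).
  rewrite big_seq_cond [leRHS]big_seq_cond [leRHS](bigID (fun i => sat_dnf (bits (int_world i)) F)) /=.
  rewrite -[leLHS]addr0; apply: lerD; last exact: sumr_ge0.
  rewrite le_eqVlt; apply/orP; left; apply/eqP; apply: eq_bigl => i.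
  case si: (i \in s) => //=; rewrite andbC; case H: sat_dnf => //=.
  have /hasP[t tF st] := H.
  by apply/esym/mem_set/sat_goal/(proj1 (sat_goal_ann i tF)) => //; exact: sat.
rewrite [RHS](partition_big (fun i => int_world i) (fun w => sat_dnf (bits w) F)) //.
apply: eq_bigr => w sw; apply: eq_bigl => i.
by case: eqP => [->|]; rewrite ?sw ?andbF.
Qed.

(** The least database allowed by the ABox in the world [w]; choosing it over every world makes the
    lower bound an equality. *)
Definition dnf_db (w : W) : database CD :=
  fun f => sat_dnf (bits w) F /\ f = ConceptFact CD [::] (inl [::]).
Definition dnf_int (w : W) : I := @Interpretation R CD KB (dnf_db w) w.
Definition dnf_model (i : I) : R := if i == dnf_int (int_world i) then 2 ^- K else 0.

Lemma dnf_model_sum (A : set I) :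
  \sum_(i \in A) dnf_model i = \sum_(w : W | dnf_int w \in A) 2 ^- K.
Proof.
have ij : injective dnf_int by move=> w w' [].
rewrite (fsum_seq _ (s := [seq dnf_int w | w : W])).
- rewrite big_map big_enum_cond /=; apply: eq_bigr => w _.
  by rewrite /dnf_model eqxx.
- by rewrite map_inj_uniq ?enum_uniq.
- move=> i; rewrite /dnf_model; case: (i =P dnf_int _) => [E _|]; last by rewrite eqxx.
  by rewrite E map_f ?mem_enum.
Qed.

Lemma sum_worlds : \sum_(w : W) 2 ^- K = 1 :> R.
Proof.
rewrite sumr_const card_ffun card_bool (_ : #|_| = K); last exact: card_gatoms.
by rewrite -[LHS]mulr_natl natrX divff // expf_neq0 // pnatr_eq0.
Qed.

Lemma dnf_model_is_model : is_model dnf_model.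
Proof.
have fin : finite_set [set i | dnf_model i != 0].
  apply: (@sub_finite_set _ _ (dnf_int @` [set: W])); last exact/finite_image/finite_finset.
  move=> i /=; rewrite /dnf_model; case: (i =P dnf_int _) => [E _|]; last by rewrite eqxx.
  by exists (int_world i).
have wfdb i : dnf_model i != 0 -> wf_database (kb_ind KB) (int_db i).
  rewrite /dnf_model; case: (i =P dnf_int _) => [E _|]; last by rewrite eqxx.
  rewrite E; split; last by move=> g t v1 v2; move=> [h1 h2]. 
  by move=> f [_ ->] a /=; rewrite inE => /eqP[->].
have pos i : 0 <= dnf_model i by rewrite /dnf_model; case: ifP => // _; rewrite invr_ge0 exprn_ge0.
split.
- split => //.
  by rewrite dnf_model_sum -[RHS]sum_worlds; apply: eq_bigl => w; rewrite mem_set.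
- move=> p; rewrite /ontology /= -map_comp => /List.in_map_iff[t [<- /In_mem tF]] /=.
  rewrite /prob_of dnf_model_sum -[RHS]sum_worlds; apply: eq_bigl => w.
  apply/mem_set/(sat_goal_ann _ tF) => st; split => //.
  by apply/hasP; exists t.
move=> w; rewrite mln_probE /prob_of dnf_model_sum -[X in X - _]sum_worlds.
rewrite [X in X - _](bigID (fun w' => dnf_int w' \in [set i | int_sat i FFalse (annotation_of_world w)])) /=.
rewrite addrC addrK (big_pred1 w) // => w'.
apply/idP/eqP => [|-> /=].
  by move=> H; apply: contrapT => ne; case/negP: H; apply/mem_set/sat_false_world.
by apply/negP => /set_mem/sat_false_world; apply.
Qed.

Lemma dnf_model_goal : prob_of dnf_model (FAssertion (goal CD)) [::] = n_sat%:R / 2 ^+ K.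
Proof.
rewrite n_satE /prob_of dnf_model_sum; apply: eq_bigl => w.
apply/idP/idP => [/set_mem/sat_goal[]//|H].
by apply/mem_set/sat_goal; split.
Qed.

Lemma dnf_valid : valid_input [::] (uniform_mln R) d.
Proof.
split; [exact: dnf_wf_tcp|exact: dnf_atom_of_tcp|].
by exists dnf_model; exact: dnf_model_is_model.
Qed.

Lemma dnf_atom_prob : atom_prob KB (goal CD) = n_sat%:R / 2 ^+ K.
Proof.
apply/eqP; rewrite eq_le; apply/andP; split.
  apply: ge_inf.
    by exists 0 => _ [P [[P0 _ _ _] _ _] <-]; apply: fsumr_ge0.
  by exists dnf_model; [exact: dnf_model_is_model|exact: dnf_model_goal].
apply: lb_le_inf.
  by exists (prob_of dnf_model (FAssertion (goal CD)) [::]), dnf_model => //; exact: dnf_model_is_model.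
by move=> _ [P mP <-]; exact: dnf_prob_ge.
Qed.

End DnfProb.

Local Close Scope classical_set_scope.
Local Close Scope ring_scope.

(** * The tableau of a Turing machine *)

Lemma size_pair (x y : word) : size (pair_words x y) = 2 * size x + 2 + size y.
Proof.
rewrite /pair_words size_cat /=.
have -> : size (flatten [seq [:: b; b] | b <- x]) = 2 * size x by elim: x => //= b s ->; lia.
by lia.
Qed.

Section Tableau.
Variable V : tm 1.
Notation Q := (tm_state V).
Notation G := (tm_work V).
Notation sym := (option (bool + G)).
(* A cell carries a symbol and, at the head, a state; the state None is an extra
   initial state, entered one cell to the left of the input, which makes all the
   cells of the input look alike. *)
Definition cell : finType := (option (bool + G) * option (option Q))%type.
Definition blank : cell := (None, None).
Definition bit_cell (b : bool) : cell := (Some (inl b), None).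
Definition pre_cell : cell := (None, Some None).

Definition tm_act (q : Q) (s : sym) : option (Q * (sym * move)) :=
  omap (fun r : Q * {ffun 'I_1 -> symbol G * move} => (r.1, r.2 ord0)) (tm_delta q [ffun=> s]).

(** A halted head gets a step that changes nothing, so the rows can be continued past the halting
    time. *)
Definition cell_act (z : cell) : option (Q * (sym * move)) :=
  match z.2 with
  | None => None
  | Some None => Some (tm_start V, (z.1, MRight))
  | Some (Some q) => Some (odflt (q, (z.1, MStay)) (tm_act q z.1))
  end.

Definition next_cell (l m r : cell) : cell :=
  (if cell_act m is Some (_, (s, _)) then s else m.1,
   match cell_act l, cell_act m, cell_act r with
   | Some (q, (_, MRight)), _, _ => Some (Some q)
   | _, Some (q, (_, MStay)), _ => Some (Some q)
   | _, _, Some (q, (_, MLeft)) => Some (Some q)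
   | _, _, _ => None
   end).

(** Halted without accepting. Acceptance becomes a condition on single cells, and the time at which
    the machine halts need not be located. *)
Definition bad_cell (z : cell) : bool :=
  if z.2 is Some (Some q) then ~~ tm_act q z.1 && ~~ tm_accept q else false.

Definition code_size : nat := #|cell|.+1.
Definition cell_bit (z : cell) : option bool :=
  if z is (Some (inl b), None) then Some b else None.
(* The code of an input bit has that bit in front and is otherwise independent of
   it, so that leaving one variable free leaves exactly that bit open. *)
Definition code (z : cell) : seq bool :=
  if cell_bit z is Some b then b :: nseq #|cell| false
  else false :: [seq z == z' | z' <- enum cell].
Definition decode (s : seq bool) : cell := odflt blank [pick z | code z == s].

Lemma cell_bitE z b : cell_bit z = Some b -> z = bit_cell b.
Proof. by case: z => [[[b'|g]|] [q|]] //= [->]. Qed.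

Lemma size_code z : size (code z) = code_size.
Proof.
rewrite /code; case: cell_bit => [b|] /=; first by rewrite size_nseq.
by rewrite size_map -cardE.
Qed.

(** The tail of a code that is not of an input bit is an indicator vector, which contains [true],
    unlike the constant tail of an input bit. *)
Lemma code_inj : injective code.
Proof.
have H z : nseq #|cell| false <> [seq z == z' | z' <- enum cell].
  move=> E; have : true \in [seq z == z' | z' <- enum cell].
    by apply/mapP; exists z; rewrite ?mem_enum ?eqxx.
  by rewrite -E mem_nseq andbF.
have H' z z' : [seq z == x | x <- enum cell] = [seq z' == x | x <- enum cell] -> z = z'.
  move=> E; have : z' \in enum cell by rewrite mem_enum.
  move/eq_in_map: E => E /E; rewrite eqxx => /eqP //.
move=> z z'; rewrite /code; case E: (cell_bit z) => [b|]; case E': (cell_bit z') => [b'|] [].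
- by move=> bb; move: E E'; rewrite bb => /cell_bitE-> /cell_bitE->.
- by move=> _ e; case: (H z').
- by move=> _ e; case: (H z).
- exact: H'.
Qed.

Lemma codeK : cancel code decode.
Proof.
move=> z; rewrite /decode; case: pickP => [z' /eqP/code_inj //|/(_ z)].
by rewrite eqxx.
Qed.

Lemma code_bit b : code (bit_cell b) = b :: nseq #|cell| false.
Proof. by []. Qed.

(** * The rows of the tableau and their local rule *)

Section Run.
Variables (u : word) (T : nat).
Hypothesis haltT : halted (@tm_step 1 V) (run (@tm_step 1 V) T (start_config V u)).

(** The head starts in column [margin.+1] and stays between columns 3 and [margin.+1 + T]. With this
    margin and [width], the first two and the last two columns are blank in every row. *)
Definition margin : nat := T.+2.
Definition width : nat := margin + size u + T + 5.

Definition move_pos (m : move) (h : nat) : nat :=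
  match m with MLeft => h.-1 | MStay => h | MRight => h.+1 end.

(** A tape is split at the head and carries no coordinates; the second component keeps the absolute
    column of the head. *)
Definition pos_step (c : config V * nat) : config V * nat :=
  if tm_act c.1.1 (tape_read (c.1.2 ord0)) is Some (q, (s, m)) then
    ((q, [ffun=> tape_move m (tape_write s (c.1.2 ord0))]), move_pos m c.2)
  else c.

Definition pos_run (t : nat) : config V * nat :=
  iter t pos_step (start_config V u, margin.+1).

Lemma tm_stepE (c : config V) : tm_step c =
  omap (fun r => (r.1, [ffun=> tape_move r.2.2 (tape_write r.2.1 (c.2 ord0))]))
    (tm_act c.1 (tape_read (c.2 ord0))).
Proof.
rewrite /tm_step /tm_act (_ : [ffun i => _] = [ffun=> tape_read (c.2 ord0)]).
  case: tm_delta => [[q a]|] //=; congr (Some (_, _)).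
  by apply/ffunP => i; rewrite !ffunE (ord1 i).
by apply/ffunP => i; rewrite !ffunE (ord1 i).
Qed.

Lemma pos_runE t : (pos_run t).1 = run (@tm_step 1 V) t (start_config V u).
Proof.
rewrite /pos_run /run; elim: t => //= t <-.
rewrite tm_stepE /pos_step; case: tm_act => [[q [s m]]|] //=.
Qed.

Lemma pos_run_halt t : T <= t -> pos_run t = pos_run T.
Proof.
move=> /subnK <-; elim: (t - T) => [|k IH] //.
rewrite addSn /pos_run iterS -/(pos_run _) IH /pos_step.
move: haltT; rewrite -pos_runE /halted tm_stepE.
by case: tm_act.
Qed.

(** Uniform in [t] because nothing moves after time [T]. *)
Lemma pos_bound t : margin.+1 - T <= (pos_run t).2 <= margin.+1 + T.
Proof.
have H k : margin.+1 - k <= (pos_run k).2 <= margin.+1 + k.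
  elim: k => [|k IH]; first by rewrite /pos_run /=; lia.
  rewrite /pos_run iterS -/(pos_run _) /pos_step.
  by case: tm_act => [[q [s m]]|] /=; [case: m => /=|]; move: IH; lia.
have [/ltnW tT|tT] := ltnP t T; first by have := H t; lia.
by rewrite (pos_run_halt tT).
Qed.

Definition tape_sym (tp : tape G) (h i : nat) : sym :=
  if i < h then nth None tp.1 (h - i).-1 else nth None tp.2 (i - h).

(** A move only splits the tape at another place: the content of an absolute column changes in
    column [h] alone. A positive [h] makes [h.-1] a genuine neighbour. *)
Lemma tape_sym_step tp h m s i : 0 < h ->
  tape_sym (tape_move m (tape_write s tp)) (move_pos m h) i =
  if i == h then s else tape_sym tp h i.
Proof.
case: tp => l r; rewrite /tape_sym => h0.
have Ebeh k : nth None (behead r) k = nth None r k.+1 by case: r; rewrite //= nth_nil.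
have Ebehl k : nth None (behead l) k = nth None l k.+1 by case: l; rewrite //= nth_nil.
case: m => /=.
- case: (ltngtP i h) => [ih|ih|->].
  + case: ifP => H; first by rewrite Ebehl; congr nth; lia.
    have -> : i - h.-1 = 0 by lia.
    have -> : (h - i).-1 = 0 by lia.
    by rewrite nth0.
  + rewrite ifF; last by lia.
    have -> : i - h.-1 = (i - h).-1.+2 by lia.
    by rewrite /= Ebeh; congr nth; lia.
  + have -> : h - h.-1 = 1 by lia.
    by rewrite ifF //; lia.
- case: (ltngtP i h) => [//|ih|->]; last by rewrite subnn.
  have -> : i - h = (i - h).-1.+1 by lia.
  by rewrite /= Ebeh.
- case: (ltngtP i h) => [ih|ih|->].
  + rewrite ifT; last by lia.
    by have -> : (h.+1 - i).-1 = (h - i).-1.+1 by lia.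
  + rewrite ifF; last by lia.
    by rewrite Ebeh; congr nth; lia.
  + by rewrite ltnS leqnn subSnn.
Qed.

Definition cell_at (c : config V * nat) (i : nat) : cell :=
  (tape_sym (c.1.2 ord0) c.2 i, if i == c.2 then Some (Some c.1.1) else None).

Definition row (t i : nat) : cell :=
  if t is t'.+1 then cell_at (pos_run t') i
  else (tape_sym (tape_of_word G u) margin.+1 i, if i == margin then Some None else None).

Lemma tape_sym_read tp h : tape_sym tp h h = tape_read tp.
Proof. by rewrite /tape_sym ltnn subnn nth0. Qed.

(** A cell can change only if the head is in it or next to it, which gives four cases: head in the
    middle, left, right, or elsewhere. In row 0 the extra state steps right into the start state. *)
Lemma row_next t i : row t.+1 i.+1 = next_cell (row t i) (row t i.+1) (row t i.+2).
Proof.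
case: t => [|t] /=.
  rewrite /pos_run /= /cell_at /start_config /= ffunE /next_cell /cell_act /=.
  rewrite eqSS; case: (i =P margin) => [->|ne].
    by rewrite ifF //; lia.
  by case: (i.+1 == margin); case: (i.+2 == margin).
have := pos_bound t; case: (pos_run t) => -[q tps] h /= hb.
have h0 : 0 < h by rewrite /margin in hb; lia.
have [ih|nih] := eqVneq i.+1 h.
  subst h; rewrite /cell_at /next_cell /cell_act /= eqxx tape_sym_read.
  have [-> ->] : (i == i.+1) = false /\ (i.+2 == i.+1) = false by split; lia.
  rewrite /pos_step /=; case E: (tm_act q _) => [[q' [s m]]|] /=; last first.
    by rewrite eqxx tape_sym_read.
  rewrite ffunE tape_sym_step // eqxx.
  by case: m {E} => /=; rewrite ?eqxx //; [have -> : (i.+1 == i) = false by lia|have -> : (i.+1 == i.+2) = false by lia].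
rewrite /cell_at /next_cell /cell_act /= (negbTE nih).
have -> : tape_sym ((pos_step (q, tps, h)).1.2 ord0) (pos_step (q, tps, h)).2 i.+1 = tape_sym (tps ord0) h i.+1.
  rewrite /pos_step /=; case E: (tm_act q _) => [[q' [s m]]|] //=.
  by rewrite ffunE tape_sym_step // (negbTE nih).
congr (_, _).
have [ih|nih'] := eqVneq i h.
  subst h; rewrite tape_sym_read /pos_step /=.
  have [-> ne] : (i.+2 == i) = false /\ (i.+1 == i) = false by split; lia.
  case E: (tm_act q _) => [[q' [s m]]|] /=; last by rewrite ne.
  by case: m {E} => /=; rewrite ?eqxx ?ne //; have -> : (i.+1 == i.-1) = false by lia.
have [ih|nih''] := eqVneq i.+2 h.
  subst h; rewrite tape_sym_read /pos_step /=.
  have ne : (i.+1 == i.+2) = false by lia.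
  case E: (tm_act q _) => [[q' [s m]]|] /=; last by rewrite ne.
  by case: m {E} => /=; rewrite ?eqxx ?ne //; have -> : (i.+1 == i.+3) = false by lia.
rewrite /pos_step /=; case E: (tm_act q _) => [[q' [s m]]|] /=; last by rewrite ifF //; lia.
by rewrite ifF //; case: m {E} => /=; lia.
Qed.

Lemma tape_sym_start i : margin.+1 + size u <= i \/ i <= margin ->
  tape_sym (tape_of_word G u) margin.+1 i = None.
Proof.
rewrite /tape_sym /=; case: ifP => H1; first by rewrite nth_nil.
by move=> H2; rewrite nth_default // size_map; lia.
Qed.

(** Only columns visited by the head are written, and [pos_bound] confines these. *)
Lemma pos_sym_blank t i : i < 3 \/ margin.+1 + size u + T < i ->
  tape_sym ((pos_run t).1.2 ord0) (pos_run t).2 i = None.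
Proof.
move=> H; elim: t => [|t IH].
  by rewrite /pos_run /= ffunE tape_sym_start //; move: H; rewrite /margin; lia.
rewrite /pos_run iterS -/(pos_run t).
have := pos_bound t; move: IH; case: (pos_run t) => -[q tps] h /= IH hb.
rewrite /pos_step /=; case E: (tm_act q _) => [[q' [s m]]|] //=.
rewrite ffunE tape_sym_step; last by rewrite /margin in hb; lia.
by rewrite IH ifF //; move: hb H; rewrite /margin; lia.
Qed.

Lemma row_blank t i : i < 2 \/ width - 2 <= i -> row t i = blank.
Proof.
rewrite /width => H; case: t => [|t] /=.
  rewrite tape_sym_start; last by rewrite /margin in H *; lia.
  by rewrite ifF //; rewrite /margin in H *; lia.
have := pos_bound t; have := @pos_sym_blank t i; rewrite /cell_at.
case: (pos_run t) => -[q tps] h /= -> ; last by rewrite /margin in H *; lia.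
by move=> hb; rewrite ifF //; move: H hb; rewrite /margin; lia.
Qed.

(* The rows are concatenated, so that cells c, c + 1 and c + 2 determine cell
   c + width + 1; windows across the end of a row are harmless because the
   margins stay blank. *)
Definition tableau (c : nat) : cell := row (c %/ width) (c %% width).

Lemma tableau_row t i : i < width -> tableau (t * width + i) = row t i.
Proof.
by move=> iW; rewrite /tableau divnMDl ?divn_small ?addn0 ?modnMDl ?modn_small //; lia.
Qed.

Lemma tableau_next c : tableau (c + width.+1) = next_cell (tableau c) (tableau c.+1) (tableau c.+2).
Proof.
have W0 : 5 < width by rewrite /width /margin; lia.
have := ltn_pmod c.+1 (ltnW (ltnW (ltnW (ltnW (ltnW W0))))).
move: (divn_eq c.+1 width).
move: (c.+1 %/ width) (c.+1 %% width) => t i Ec iW.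
have -> : c + width.+1 = t.+1 * width + i by rewrite mulSn; lia.
(* [i] is the column of the middle cell. In column 0 the window begins in the previous row, and in
   the last column it ends in the next one; all cells concerned are then blank. *)
rewrite Ec !tableau_row //; case: i => [|i] in Ec iW *.
  case: t => [|t] in Ec *; first by lia.
  have -> : c = t * width + width.-1 by rewrite mulSn in Ec; lia.
  rewrite -addnS !tableau_row; [|lia..].
  by rewrite !row_blank //; lia.
have -> : c = t * width + i by lia.
rewrite -addnS tableau_row; last by lia.
have [iW'|iW'] := leqP width i.+2; last by rewrite tableau_row ?row_next.
have -> : t * width + i.+2 = t.+1 * width + 0 by rewrite mulSn; lia.
by rewrite tableau_row ?row_blank //; lia.
Qed.

(** Row [T.+1] is the configuration after [T] steps, and [N] windows reach that far. The index is
    [c.+1] because a window inspects its middle cell. *)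
Lemma tableau_bad N : T.+2 * width <= N ->
  (exists2 c, c < N & bad_cell (tableau c.+1)) <->
  ~~ tm_accept (run (@tm_step 1 V) T (start_config V u)).1.
Proof.
move=> TN; rewrite -pos_runE; split.
  move=> [c _]; rewrite /tableau; move: (_ %/ _) (_ %% _) => [|t] i.
    by rewrite /bad_cell /=; case: ifP.
  rewrite /row /bad_cell /cell_at /=; case: eqP => // -> /=.
  rewrite tape_sym_read; case E: tm_act => //= nacc.
  (* A halted row repeats itself, so the halted row [t] and the row of time [T] agree, whichever
     comes first. *)
  suff -> : pos_run T = pos_run t by [].
  have [tT|/pos_run_halt -> //] := ltnP t T.
  rewrite -(subnK (ltnW tT)); elim: (T - t) => [//|k IH].
  by rewrite addSn /pos_run iterS -/(pos_run _) IH /pos_step E.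
move=> nacc; have := pos_bound T; have hh := haltT.
rewrite -pos_runE /halted tm_stepE in hh.
move: nacc hh; case E: (pos_run T) => [[q tps] h] /= nacc hh hb.
have hW : h < width by move: hb; rewrite /margin /width /margin; lia.
have W0 : 5 < width by rewrite /width /margin; lia.
exists (T.+1 * width + h).-1; first by rewrite mulSn in TN; lia.
rewrite prednK; last by rewrite mulSn; lia.
rewrite tableau_row // /row E /bad_cell /cell_at /= eqxx tape_sym_read nacc andbT.
by case: tm_act hh.
Qed.

(** One cell longer than a row: [tableau_next] reaches back [width.+1] cells, so that many have to
    be prescribed. *)
Definition row_cells : seq cell :=
  nseq margin blank ++ pre_cell :: [seq bit_cell b | b <- u] ++ nseq (T + 5) blank.

Lemma tableau_row_cells c : c <= width -> tableau c = nth blank row_cells c.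
Proof.
rewrite leq_eqVlt => /orP[/eqP ->|cW].
  rewrite -[X in tableau X]mul1n -[X in tableau X]addn0 tableau_row; last by rewrite /width /margin; lia.
  rewrite row_blank; last by left.
  rewrite nth_cat size_nseq ifF; last by rewrite /width /margin; lia.
  case E: (width - margin) => [|k]; first by move: E; rewrite /width /margin; lia.
  rewrite /= nth_cat size_map ifF; last by move: E; rewrite /width /margin; lia.
  by rewrite nth_nseq if_same.
rewrite -[X in tableau X](add0n c) -(mul0n width) tableau_row // /row /tape_sym /=.
rewrite nth_cat size_nseq nth_nseq; case: (ltngtP c margin) => H; last 1 first.
- by rewrite H subnn ltnSn nth_nil.
- by rewrite ifT ?nth_nil //; lia.
rewrite ltnNge H /=.
have -> : c - margin = (c - margin.+1).+1 by lia.
rewrite /= nth_cat size_map nth_nseq if_same; case: ltnP => H'.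
  by rewrite !(nth_map false).
by rewrite nth_default // size_map.
Qed.
End Run.

(** * Local constraints as terms *)

(* A literal of a template is a flag, an offset and a sign; at base b it denotes the
   variable b + offset or, with the flag set, D + b + offset, D being the distance
   between a cell and the one below it to the right. *)
Definition template := seq (bool * nat * bool).
Definition inst (b D : nat) (tm : template) : seq literal :=
  [seq ((if l.1.1 then D + b + l.1.2 else b + l.1.2), l.2) | l <- tm].
Definition fact_template (a : word) : template :=
  [seq (false, o, nth false a o) | o <- iota 0 (size a)].
Definition all_words (n : nat) : seq word := [seq tval t | t : n.-tuple bool].

Definition next_word (a : word) : word :=
  code (next_cell (decode (take code_size a)) (decode (take code_size (drop code_size a)))
                  (decode (drop (2 * code_size) a))).

(** A truth table over all contents [a] of three cells: a term for each [a] with a bad middle cell,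
    and, for each [a] and each bit [j] of the cell below, a term saying that this bit is wrong. Its
    size depends on the machine only. *)
Definition step_block : seq template :=
  [seq fact_template a | a <- all_words (3 * code_size)
     & bad_cell (decode (take code_size (drop code_size a)))] ++
  flatten [seq [seq (true, j, ~~ nth false (next_word a) j) :: fact_template a
               | j <- iota 0 code_size] | a <- all_words (3 * code_size)].
Definition cell_block (z : cell) : seq template :=
  [seq [:: (false, o, ~~ nth false (code z) o)] | o <- iota 0 code_size].
(** [behead] drops the constraint on the leading bit, the only place where the codes of the two
    input bits differ. *)
Definition free_block : seq template := behead (cell_block (bit_cell false)).

Section Blocks.
Variables (w : nat -> bool) (D b : nat).

Definition word_at (c n : nat) : word := [seq w (c + o) | o <- iota 0 n].
Definition violated (B : seq template) : bool :=
  has (fun tm => sat_term w (inst b D tm)) B.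

Lemma size_word_at c n : size (word_at c n) = n.
Proof. by rewrite size_map size_iota. Qed.

Lemma nth_word_at c n o : o < n -> nth false (word_at c n) o = w (c + o).
Proof. by move=> on; rewrite (nth_map 0) ?size_iota // nth_iota. Qed.

Lemma word_at_catl c n m : take n (word_at c (n + m)) = word_at c n.
Proof. by rewrite /word_at iotaD map_cat take_size_cat // size_map size_iota. Qed.

Lemma word_at_catr c n m : drop n (word_at c (n + m)) = word_at (c + n) m.
Proof.
rewrite /word_at iotaD map_cat drop_size_cat ?size_map ?size_iota // add0n.
by rewrite -[X in iota X]addn0 iotaDl -map_comp; apply: eq_map => o /=; rewrite addnA.
Qed.

Lemma mem_all_words n (a : word) : (a \in all_words n) = (size a == n).
Proof.
apply/mapP/eqP => [[t _ ->]|/eqP an]; first by rewrite size_tuple.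
by exists (Tuple an); rewrite ?mem_enum.
Qed.

Lemma sat_inst_cons l tm : sat_term w (inst b D (l :: tm)) =
  (w (if l.1.1 then D + b + l.1.2 else b + l.1.2) == l.2) && sat_term w (inst b D tm).
Proof. by []. Qed.

Lemma sat_fact a : sat_term w (inst b D (fact_template a)) = (word_at b (size a) == a).
Proof.
rewrite /sat_term /inst /fact_template -map_comp all_map.
apply/allP/eqP => [H|<- o]; last first.
  by rewrite mem_iota size_word_at => /andP[_ oa]; rewrite /= nth_word_at.
apply: (@eq_from_nth _ false); first by rewrite size_word_at.
rewrite size_word_at => o oa; rewrite nth_word_at //.
by apply/eqP/(H o); rewrite mem_iota.
Qed.

Lemma step_blockP : ~~ violated step_block <->
  ~~ bad_cell (decode (word_at (b + code_size) code_size)) /\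
  word_at (D + b) code_size =
    code (next_cell (decode (word_at b code_size)) (decode (word_at (b + code_size) code_size))
                    (decode (word_at (b + 2 * code_size) code_size))).
Proof.
(* Only terms built from the actual content [a] of the window can be true. *)
set a := word_at b (3 * code_size).
have Ea1 : take code_size a = word_at b code_size.
  by rewrite /a (_ : 3 * code_size = code_size + 2 * code_size) ?word_at_catl //; lia.
have Ea2 : take code_size (drop code_size a) = word_at (b + code_size) code_size.
  rewrite /a (_ : 3 * code_size = code_size + (code_size + code_size)); last by lia.
  by rewrite word_at_catr word_at_catl.
have Ea3 : drop (2 * code_size) a = word_at (b + 2 * code_size) code_size.
  by rewrite /a (_ : 3 * code_size = 2 * code_size + code_size) ?word_at_catr //; lia.
have Ena : next_word a = code (next_cell (decode (word_at b code_size))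
    (decode (word_at (b + code_size) code_size)) (decode (word_at (b + 2 * code_size) code_size))).
  by rewrite /next_word Ea1 Ea2 Ea3.
have sa : size a = 3 * code_size by rewrite size_word_at.
have aw : a \in all_words (3 * code_size) by rewrite mem_all_words sa.
rewrite -Ena -Ea2 /violated has_cat negb_or; split.
  move=> /andP[/hasPn H1 /hasPn H2]; split.
    apply/negP => bad; have := H1 (fact_template a).
    by rewrite sat_fact sa eqxx map_f => [/(_ isT)|] //; rewrite mem_filter bad.
  apply: (@eq_from_nth _ false); first by rewrite size_word_at size_code.
  rewrite size_word_at => j jl; rewrite nth_word_at //.
  have := H2 ((true, j, ~~ nth false (next_word a) j) :: fact_template a).
  rewrite sat_inst_cons sat_fact sa eqxx andbT => H.
  have : (w (D + b + j) != ~~ nth false (next_word a) j).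
    apply: H; apply/flattenP; exists [seq (true, j, ~~ nth false (next_word a) j) :: fact_template a
               | j <- iota 0 code_size]; first exact: map_f aw.
    by apply/mapP; exists j; rewrite ?mem_iota.
  by case: (w _); case: nth.
move=> [H1 H2]; apply/andP; split; apply/hasPn => tm.
  move=> /mapP[a']; rewrite mem_filter mem_all_words => /andP[bad /eqP sa'] ->.
  rewrite sat_fact sa'; apply: contraNN H1 => /eqP aa'.
  by rewrite /a aa'.
move=> /flattenP[s /mapP[a']]; rewrite mem_all_words => /eqP sa' -> /mapP[j].
rewrite mem_iota => /andP[_ jl] ->.
rewrite sat_inst_cons sat_fact sa' /=.
case: (_ =P a') => [<-|]; last by rewrite andbF.
by rewrite -/a -H2 nth_word_at // andbT; case: (w _).
Qed.

Lemma cell_blockP z : ~~ violated (cell_block z) <-> word_at b code_size = code z.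
Proof.
rewrite /violated; split.
  move=> /hasPn H; apply: (@eq_from_nth _ false); first by rewrite size_word_at size_code.
  rewrite size_word_at => o ol; rewrite nth_word_at //.
  have := H [:: (false, o, ~~ nth false (code z) o)].
  rewrite (map_f (fun o => [:: (false, o, ~~ nth false (code z) o)])) ?mem_iota //.
  by move=> /(_ isT); rewrite /= andbT; case: (w _); case: nth.
move=> E; apply/hasPn => tm /mapP[k]; rewrite mem_iota => /andP[_ kl] ->.
by rewrite /= -E nth_word_at // andbT; case: (w _).
Qed.

Lemma free_blockP : ~~ violated free_block <-> word_at b code_size = code (bit_cell (w b)).
Proof.
rewrite -cell_blockP /violated /free_block /cell_block /code_size !code_bit /=.
(* Relative to the code of the bit [w b] itself, the dropped constraint can never be violated. *)
rewrite andbT addn0 (_ : (w b == ~~ w b) = false) /=; last by case: (w b).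
suff -> : [seq [:: (false, o, ~~ nth false (false :: nseq #|cell| false) o)] | o <- iota 1 #|cell|]
  = [seq [:: (false, o, ~~ nth false (w b :: nseq #|cell| false) o)] | o <- iota 1 #|cell|] by [].
by apply/eq_in_map => -[|o]; rewrite mem_iota.
Qed.
End Blocks.

(** Later blocks are put in front, since the program writes its output from the end. *)
Fixpoint instances (D b : nat) (s : seq (seq template)) (F : seq (seq literal)) :=
  if s is B :: s' then instances D (b + code_size) s' ([seq inst b D tm | tm <- B] ++ F) else F.

Lemma sat_instances w D s F b : ~~ sat_dnf w (instances D b s F) <->
  ~~ sat_dnf w F /\ forall c, c < size s -> ~~ violated w D (b + c * code_size) (nth [::] s c).
Proof.
elim: s b F => [|B s IH] b F /=; first by split=> [|[]].
rewrite IH /sat_dnf has_cat has_map negb_or; split.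
  move=> [/andP[H1 H2] H]; split=> // -[|c] cs; first by rewrite addn0.
  by have := H c cs; rewrite mulSn addnA.
move=> [H1 H]; split; last by move=> c cs; have := H c.+1 cs; rewrite mulSn addnA.
by rewrite H1 andbT; have := H 0 isT; rewrite addn0.
Qed.

Lemma instances_all (P : pred (seq literal)) D s F b :
  all P F -> (forall c, c < size s ->
    all (fun tm => P (inst (b + c * code_size) D tm)) (nth [::] s c)) ->
  all P (instances D b s F).
Proof.
elim: s b F => [|B s IH] b F //= PF H; apply: IH.
  by rewrite all_cat PF andbT all_map; have := H 0 isT; rewrite addn0.
by move=> c cs; have := H c.+1 cs; rewrite mulSn addnA.
Qed.

Definition pre_blocks (L : nat) (x : word) : seq (seq template) :=
  nseq L (cell_block blank) ++ cell_block pre_cell ::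
  flatten [seq [:: cell_block (bit_cell b); cell_block (bit_cell b)] | b <- x] ++
  [:: cell_block (bit_cell false); cell_block (bit_cell true)].
Definition row_blocks (L R q : nat) (x : word) : seq (seq template) :=
  pre_blocks L x ++ nseq q free_block ++ nseq R (cell_block blank).

(** * Worlds without violations and accepted witnesses *)

Section Count.
Variables (x : word) (q T N : nat).
Hypothesis haltT : forall y : q.-tuple bool,
  halted (@tm_step 1 V) (run (@tm_step 1 V) T (start_config V (pair_words x y))).
Let acc (y : word) := tm_accept (run (@tm_step 1 V) T (start_config V (pair_words x y))).1.
Let W := margin T + (2 * size x + 2 + q) + T + 5.
Hypothesis leN : T.+2 * W <= N.
Let D := W.+1 * code_size.
Let K := (W.+1 + N) * code_size.
Let off := margin T + 1 + (2 * size x + 2).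

Definition tableau_dnf : seq (seq literal) :=
  instances D 0 (row_blocks (margin T) (T + 5) q x) (instances D 0 (nseq N step_block) [::]).

Definition witness (w : nat -> bool) : q.-tuple bool :=
  [tuple w ((off + i) * code_size) | i < q].

Lemma width_pair (y : q.-tuple bool) : width (pair_words x y) T = W.
Proof. by rewrite /width size_pair size_tuple. Qed.

Definition pre_cells : seq cell :=
  nseq (margin T) blank ++ pre_cell ::
  [seq bit_cell b | b <- flatten [seq [:: b; b] | b <- x] ++ [:: false; true]].

Lemma pre_blocksE : pre_blocks (margin T) x = [seq cell_block z | z <- pre_cells].
Proof.
rewrite /pre_blocks /pre_cells map_cat map_nseq; congr (_ ++ _) => /=.
rewrite -map_comp map_cat; congr (_ :: _ ++ _).
by elim: x => //= b s ->.
Qed.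

Lemma size_pre_cells : size pre_cells = off.
Proof.
rewrite /pre_cells /off size_cat /= size_nseq size_map -addnA; congr (_ + _).
rewrite size_cat /= add1n; congr (_.+1 + _).
by elim: x => //= b s ->; lia.
Qed.

Lemma row_cells_pair y : row_cells (pair_words x y) T =
  pre_cells ++ [seq bit_cell b | b <- y] ++ nseq (T + 5) blank.
Proof.
by rewrite /row_cells /pre_cells -catA /= /pair_words !map_cat -!catA.
Qed.

Lemma size_row_blocks : size (row_blocks (margin T) (T + 5) q x) = W.+1.
Proof.
rewrite /row_blocks pre_blocksE !size_cat size_map size_pre_cells !size_nseq /off /W; lia.
Qed.

(** The tableau is that of the witness read off from [w] itself, so the free cells agree with it as
    soon as they hold codes of input bits. *)
Lemma row_blocksP w :
  (forall c, c < W.+1 ->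
    ~~ violated w D (c * code_size) (nth [::] (row_blocks (margin T) (T + 5) q x) c)) <->
  (forall c, c < W.+1 -> word_at w (c * code_size) code_size =
    code (tableau (pair_words x (witness w)) T c)).
Proof.
suff H c : c < W.+1 ->
    ~~ violated w D (c * code_size) (nth [::] (row_blocks (margin T) (T + 5) q x) c) <->
    word_at w (c * code_size) code_size =
    code (tableau (pair_words x (witness w)) T c).
  by split=> H' c cW; apply/H => //; exact: H'.
move=> cW; rewrite (tableau_row_cells (haltT _)) ?width_pair // row_cells_pair.
rewrite /row_blocks pre_blocksE; move: pre_cells size_pre_cells => P sP.
rewrite !nth_cat size_map sP.
case: ltnP => H1.
  by rewrite (nth_map blank) ?sP //; exact: cell_blockP.
rewrite size_nseq size_map size_tuple; case: ltnP => H2.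
  rewrite nth_nseq H2 (nth_map false) ?size_tuple //.
  rewrite -[X in nth false _ X]/(val (Ordinal H2)) -tnth_nth tnth_mktuple /= subnKC //.
  exact: free_blockP.
have H3 : c - off - q < T + 5 by move: cW; rewrite /W /off; lia.
by rewrite !nth_nseq H3; exact: cell_blockP.
Qed.

(** Strong induction on cells: the first [W.+1] are fixed by the row blocks, and cell [c] by the
    step block at [c - W.+1]. Once all cells are right, the tests for bad cells say that the run
    accepts. *)
Lemma tableau_dnfP w : ~~ sat_dnf w tableau_dnf <->
  (forall c, c < W.+1 + N -> word_at w (c * code_size) code_size =
    code (tableau (pair_words x (witness w)) T c)) /\ acc (witness w).
Proof.
set u := pair_words x (witness w).
have Wu : width u T = W by exact: width_pair.
have hu : halted (@tm_step 1 V) (run (@tm_step 1 V) T (start_config V u)) by exact: haltT.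
have leN' : T.+2 * width u T <= N by rewrite Wu.
have accE := tableau_bad hu leN'.
rewrite /tableau_dnf !sat_instances size_row_blocks size_nseq.
(* The three cells of the window must already hold codes, for [decode] to recover them. *)
have stepE c : (forall c', c' < c + W.+1 -> word_at w (c' * code_size) code_size =
      code (tableau u T c')) ->
    ~~ violated w D (c * code_size) step_block <->
    ~~ bad_cell (tableau u T c.+1) /\ word_at w ((c + W.+1) * code_size) code_size =
      code (tableau u T (c + W.+1)).
  move=> H; rewrite step_blockP.
  have -> : D + c * code_size = (c + W.+1) * code_size by rewrite addnC /D mulnDl.
  have -> : c * code_size + code_size = c.+1 * code_size by rewrite mulSn addnC.
  have -> : c * code_size + 2 * code_size = c.+2 * code_size by rewrite -mulnDl addn2.
  have W0 : 5 < W by rewrite /W /margin; lia.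
  have := tableau_next hu c; rewrite Wu => ->.
  by rewrite (H c) ?(H c.+1) ?(H c.+2) ?codeK //; lia.
split.
  move=> [[_ H1] H2].
  have {}H2 : forall c, c < W.+1 -> ~~ violated w D (c * code_size) (nth [::] (row_blocks (margin T) (T + 5) q x) c).
    by move=> c cW; have := H2 c cW; rewrite add0n.
  have {}H1 : forall c, c < N -> ~~ violated w D (c * code_size) step_block.
    by move=> c cN; have := H1 c cN; rewrite add0n nth_nseq cN.
  have A : forall c, c < W.+1 + N -> word_at w (c * code_size) code_size = code (tableau u T c).
    elim/ltn_ind => c IH cK; have [cW|cW] := ltnP c W.+1; first exact: (proj1 (row_blocksP w)).
    have IH' c' : c' < c - W.+1 + W.+1 -> word_at w (c' * code_size) code_size = code (tableau u T c').
      by rewrite subnK // => cc'; apply: IH => //; lia.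
    have cN : c - W.+1 < N by lia.
    by have [+ _] := stepE _ IH' => /(_ (H1 _ cN))[_]; rewrite subnK.
  split => //; apply: contraT => /accE[c cN].
  have A' c' : c' < c + W.+1 -> word_at w (c' * code_size) code_size = code (tableau u T c').
    by move=> cc'; apply: A; lia.
  by have [/(_ (H1 _ cN))[/negP]] := stepE c A'.
move=> [A ac].
split; last by move=> c; rewrite add0n; move: c; apply/row_blocksP => c cW; apply: A; lia.
split => // c cN; rewrite add0n nth_nseq cN; apply/stepE; first by move=> c' cc'; apply: A; lia.
split; last by apply: A; lia.
apply/negP => bad; suff /negP : ~~ acc (witness w) by [].
by apply/accE; exists c.
Qed.

Lemma fact_template_wf b k a :
  uniq (unzip1 (inst b k (fact_template a))) /\
  forall l, l \in inst b k (fact_template a) -> b <= l.1 < b + size a.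
Proof.
have E : unzip1 (inst b k (fact_template a)) = iota b (size a).
  rewrite /unzip1 /inst /fact_template -!map_comp -[X in _ = iota X _]addn0 iotaDl.
  exact: eq_map.
split; first by rewrite E iota_uniq.
by move=> l lt; have := map_f fst lt; rewrite -/(unzip1 _) E mem_iota.
Qed.

(** Needed because the goal has to occur in the ontology. Without terms the all-true world would
    violate nothing, but cell 0 is blank and its code begins with [false]. *)
Lemma tableau_dnf_neq0 : tableau_dnf != [::].
Proof.
apply/eqP => E; have := proj1 (tableau_dnfP (fun=> true)).
rewrite E => /(_ isT)[/(_ 0 isT) + _].
by rewrite (tableau_row_cells (haltT _)) // => /(congr1 (nth false ^~ 0)).
Qed.

Lemma tableau_dnf_wf : wf_dnf K tableau_dnf.
Proof.
(* The cell below lies beyond the three cells of the window, so no variable occurs twice in a step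
   term. *)
have D3 : 3 * code_size <= D by rewrite /D /W leq_mul2r; apply/orP; right; lia.
rewrite /wf_dnf tableau_dnf_neq0 /=.
set P := (fun t : seq literal => _).
have cellP b z : b + code_size <= K -> all (fun tm => P (inst b D tm)) (cell_block z).
  move=> bK; apply/allP => tm /mapP[k]; rewrite mem_iota => /andP[_ ol] ->.
  by rewrite /P /= andbT; lia.
have freeP b : b + code_size <= K -> all (fun tm => P (inst b D tm)) free_block.
  by move=> bK; have := cellP b (bit_cell false) bK; rewrite /free_block; case: cell_block => //= ? ? /andP[].
have mulK c : c < W.+1 + N -> c * code_size + code_size <= K.
  by move=> cK; rewrite addnC -mulSn leq_mul2r cK orbT.
apply: instances_all; first apply: instances_all => //.
  move=> c; rewrite size_nseq add0n nth_nseq => cN; rewrite cN.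
  have DK : D + c * code_size + code_size <= K.
    by rewrite /D -mulnDl mulK //; lia.
  rewrite /step_block all_cat; apply/andP; split; apply/allP => tm.
    move=> /mapP[a]; rewrite mem_filter mem_all_words => /andP[_ /eqP sa] ->.
    have [U H] := fact_template_wf (c * code_size) D a.
    rewrite /P U /=; apply/allP => l /H /andP[_]; rewrite sa => /leq_trans; apply.
    by rewrite (leq_trans _ DK) //; lia.
  move=> /flattenP[s /mapP[a]]; rewrite mem_all_words => /eqP sa -> /mapP[j].
  rewrite mem_iota => /andP[_ jl] ->.
  have [U H] := fact_template_wf (c * code_size) D a.
  rewrite /P /= -/(inst _ _ _) -/(unzip1 _) U andbT; apply/andP; split.
    by apply/negP => /mapP[l /H] + /= E; rewrite sa -E; lia.
  apply/andP; split; first by lia.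
  apply/allP => l /H /andP[_]; rewrite sa => /leq_trans; apply.
  by rewrite (leq_trans _ DK) //; lia.
move=> c; rewrite size_row_blocks add0n => cW.
have {}mulK : c * code_size + code_size <= K by apply: mulK; lia.
rewrite /row_blocks pre_blocksE; move: pre_cells size_pre_cells => C sC.
rewrite !nth_cat size_map sC.
case: ltnP => H1; first by rewrite (nth_map blank) ?sC //; exact: cellP.
rewrite !nth_nseq size_nseq; case: ltnP => H2; first exact: freeP.
by case: ifP => // _; exact: cellP.
Qed.

Definition tableau_bit (y : word) (v : nat) : bool :=
  nth false (code (tableau (pair_words x y) T (v %/ code_size))) (v %% code_size).
(** The number of a variable is the length of its unary constant. *)
Definition tableau_world (y : word) : world unary_sig (consts K) :=
  [ffun g => tableau_bit y (size (head [::] (val g).2))].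

Lemma bits_tableau_world y v : v < K -> bits (tableau_world y) v = tableau_bit y v.
Proof.
move=> vK; apply: (proj1 (bitsE _ _ vK)).
by rewrite /world_val insubT ?gatom_ground //= => ?; rewrite ffunE /= size_nseq.
Qed.

Lemma word_at_tableau_bit (w : nat -> bool) y :
  (forall v, v < K -> w v = tableau_bit y v) <->
  (forall c, c < W.+1 + N -> word_at w (c * code_size) code_size =
     code (tableau (pair_words x y) T c)).
Proof.
have l0 : 0 < code_size by [].
split=> H.
  move=> c cK; apply: (@eq_from_nth _ false); first by rewrite size_word_at size_code.
  rewrite size_word_at => j jl; rewrite nth_word_at // H.
    by rewrite /tableau_bit divnMDl // divn_small // addn0 modnMDl modn_small.
  by rewrite (leq_trans _ (leq_mul cK (leqnn code_size))) // mulSn addnC ltn_add2r.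
move=> v vK; rewrite /tableau_bit -H ?ltn_divLR // nth_word_at ?ltn_pmod //.
by rewrite -divn_eq.
Qed.

Lemma tableau_world_word y c : c < W.+1 + N ->
  word_at (bits (tableau_world y)) (c * code_size) code_size = code (tableau (pair_words x y) T c).
Proof.
by move: c; apply/word_at_tableau_bit => v vK; rewrite bits_tableau_world.
Qed.

Lemma witness_tableau_world (y : q.-tuple bool) : witness (bits (tableau_world y)) = y.
Proof.
apply: eq_from_tnth => i; rewrite tnth_mktuple.
have iq := ltn_ord i.
have cW : off + i < W.+1 by rewrite /off /W; lia.
have := @tableau_world_word y (off + i); rewrite ltn_addr // => /(_ isT).
rewrite (tableau_row_cells (haltT _)) ?width_pair // row_cells_pair.
rewrite nth_cat size_pre_cells ifF; last by lia.
rewrite addKn nth_cat size_map size_tuple iq (nth_map false) ?size_tuple // code_bit.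
move=> /(congr1 (nth false ^~ 0)); rewrite nth_word_at // addn0 => ->.
by rewrite (tnth_nth false).
Qed.

(** [tableau_world] is inverted by reading off the witness, and a world without violations is, on
    every variable, the tableau of its own witness. *)
Lemma card_unsat_tableau :
  #|[set w : world unary_sig (consts K) | ~~ sat_dnf (bits w) tableau_dnf]|
  = #|[set y : q.-tuple bool | acc y]|.
Proof.
rewrite -(card_imset (f := fun y : q.-tuple bool => tableau_world y)).
  apply: eq_card => w; rewrite inE; apply/idP/imsetP.
    move=> /tableau_dnfP[/word_at_tableau_bit H ac].
    exists (witness (bits w)); first by rewrite inE.
    apply/ffunP => g; rewrite ffunE.
    have := valP g; rewrite ground_matomsE => /mapP[v]; rewrite mem_iota => /andP[_ vK] E.
    have -> : size (head [::] (val g).2) = v by rewrite E /= size_nseq.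
    by rewrite -H // /bits /world_val -E valK /=; case: (w g).
  move=> [y]; rewrite inE => ac ->.
  apply/tableau_dnfP; rewrite witness_tableau_world; split=> // c.
  exact: tableau_world_word.
by apply: can_inj (fun w => witness (bits w)) _ => y; exact: witness_tableau_world.
Qed.

Lemma n_sat_tableau : n_sat K tableau_dnf + #|[set y : q.-tuple bool | acc y]| = 2 ^ K.
Proof.
rewrite -card_unsat_tableau /n_sat.
rewrite (_ : [set w | ~~ _] = ~: [set w : world unary_sig (consts K) | sat_dnf (bits w) tableau_dnf]).
  by rewrite cardsC card_ffun card_bool card_gatoms.
by apply/setP => w; rewrite !inE.
Qed.
End Count.
End Tableau.

(** * Stack programs and oracle machines *)

(* Tape i is a stack with its top at the head.  Pushing takes two steps, Push moving
   left and Put writing; Put does not occur in programs otherwise. *)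
Inductive cmd :=
| Push of nat & bool
| Put of nat & bool
| Pop of nat
| Skip
| Seq of cmd & cmd
| Case of nat & cmd & cmd & cmd
| While of nat & cmd
| Ask.

HB.instance Definition _ := gen_eqMixin cmd.
HB.instance Definition _ := gen_choiceMixin cmd.

Section Machine.
Variable k : nat.
Notation sym := (symbol unit).
Definition store := seq word.

Definition act_on (i : nat) (s : sym) (m : move) (r : {ffun 'I_k.+2 -> sym}) :
    {ffun 'I_k.+2 -> sym * move} :=
  [ffun j => if val j == i then (s, m) else (r j, MStay)].
Definition no_act (r : {ffun 'I_k.+2 -> sym}) : {ffun 'I_k.+2 -> sym * move} :=
  [ffun j => (r j, MStay)].

Definition cmd_delta (c : cmd) (K : seq cmd) (r : {ffun 'I_k.+2 -> sym}) :
    seq cmd * {ffun 'I_k.+2 -> sym * move} :=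
  match c with
  | Push i b => (Put i b :: K, act_on i (r (inord i)) MLeft r)
  | Put i b => (K, act_on i (Some (inl b)) MStay r)
  | Pop i => (K, act_on i None MRight r)
  | Skip => (K, no_act r)
  | Seq c1 c2 => (c1 :: c2 :: K, no_act r)
  | Case i c0 c1 c2 =>
      ((match r (inord i) with
        | Some (inl b) => if b then c2 else c1
        | _ => c0 end) :: K, no_act r)
  | While i c1 => (if r (inord i) is Some _ then c1 :: While i c1 :: K else K, no_act r)
  | Ask => (K, no_act r)
  end.

(* The states of the machine are the finitely many continuations of the program. *)
Fixpoint conts (c : cmd) (K : seq cmd) : seq (seq cmd) :=
  (c :: K) :: match c with
  | Push i b => [:: Put i b :: K]
  | Seq c1 c2 => conts c1 (c2 :: K) ++ conts c2 K
  | Case i c0 c1 c2 => conts c0 K ++ conts c1 K ++ conts c2 K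
  | While i c1 => conts c1 (c :: K)
  | _ => [::]
  end.

Lemma conts_start c K : c :: K \in conts c K.
Proof. by case: c => *; rewrite inE eqxx. Qed.

(** The continuations are closed under steps except for the exit to [K]; adding the empty
    continuation closes the set for the whole program, so the default of [insubd] is never
    reached. *)
Lemma conts_step c K d L r : d :: L \in conts c K ->
  (cmd_delta d L r).1 \in K :: conts c K.
Proof.
elim: c K => [i b|i b|i||c1 IH1 c2 IH2|i c0 IH0 c1 IH1 c2 IH2|i c IH|] K;
  rewrite /= in_cons => /predU1P[[-> ->]|]; rewrite //= ?inE ?mem_cat ?eqxx ?orbT //.
- by move=> /eqP[-> ->]; rewrite /= eqxx.
- by rewrite conts_start !orbT.
- by case/orP=> [/IH1|/IH2]; rewrite inE => /predU1P[->|->]; rewrite ?conts_start ?eqxx ?orbT.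
- case: (r _) => [[[]|]|]; rewrite conts_start ?orbT //.
- case/or3P => [/IH0|/IH1|/IH2]; rewrite inE => /predU1P[->|->]; rewrite ?eqxx ?orbT //.
- by case: (r _) => [s|]; rewrite ?eqxx // conts_start !orbT.
- by move=> /IH; rewrite inE => /predU1P[->|->]; rewrite ?eqxx ?orbT.
Qed.

Variable prog : cmd.

Definition states : seq (seq cmd) := [::] :: conts prog [::].

Lemma states_start : [:: prog] \in states.
Proof. by rewrite inE conts_start orbT. Qed.

Definition state := seq_sub states.
Definition state0 : state := SeqSub states_start.

Lemma states_step d L r : d :: L \in states -> (cmd_delta d L r).1 \in states.
Proof. by rewrite inE /=; exact: conts_step. Qed.

Definition machine_delta (q : state) (r : {ffun 'I_k.+2 -> sym}) :
    option (state * {ffun 'I_k.+2 -> sym * move}) :=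
  if val q is c :: K then
    let: (L, a) := cmd_delta c K r in Some (insubd state0 L, a)
  else None.

Definition machine : oracle_tm :=
  @OracleTM k (@TM k.+2 state unit state0 xpred0 machine_delta)
    (fun q => if val q is Ask :: K then Some (insubd state0 K) else None).

Variable O : word -> word.

(** Up to blank padding: popping leaves blanks on the left, and rewriting the top of an empty stack
    creates one on the right. *)
Definition represents (t : tape unit) (w : word) : Prop :=
  exists a b, t = (nseq a None, [seq Some (inl x) | x <- w] ++ nseq b None).

Definition at_state (c : config machine) (K : seq cmd) (st : store) : Prop :=
  val c.1 = K /\ forall j : 'I_k.+2, represents (c.2 j) (nth [::] st j).

Definition steps (n : nat) := run (oracle_step (N := machine) O) n.

(** Quantifying over the continuation [K] makes the triples compose; taking at most [n] steps lets
    bounds be weakened. *)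
Definition exec (c : cmd) (st : store) (n : nat) (st' : store) : Prop :=
  forall K conf, at_state conf (c :: K) st ->
    exists2 t, t <= n & at_state (steps t conf) K st'.

Lemma represents_read t w : represents t w ->
  tape_read t = if w is x :: _ then Some (inl x) else None.
Proof. by move=> [a [b ->]]; case: w => //; case: b. Qed.

Lemma represents_stay t w : represents t w -> represents (tape_move MStay (tape_write (tape_read t) t)) w.
Proof.
move=> [a [b ->]]; exists a; case: w => [|x w].
  by exists b.-1.+1; case: b.
by exists b.
Qed.

Lemma represents_pop t w : represents t w ->
  represents (tape_move MRight (tape_write None t)) (behead w).
Proof.
move=> [a [b ->]]; exists a.+1; case: w => [|x w]; last by exists b.
by exists b.-1; case: b.
Qed.

Lemma represents_push t w x : represents t w -> represents
  (tape_move MStay (tape_write (Some (inl x)) (tape_move MLeft (tape_write (tape_read t) t)))) (x :: w).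
Proof.
move=> [a [b ->]]; exists a.-1; case: w => [|y w].
  by exists b.-1.+1; case: a; case: b.
by exists b; case: a.
Qed.

Lemma step_state (conf : config machine) c K
    (r : {ffun 'I_k.+2 -> sym} := [ffun i => tape_read (conf.2 i)]) : c <> Ask -> val conf.1 = c :: K ->
  exists q : state, [/\ val q = (cmd_delta c K r).1 & steps 1 conf =
    (q, [ffun i : 'I_k.+2 => tape_move ((cmd_delta c K r).2 i).2 (tape_write ((cmd_delta c K r).2 i).1 (conf.2 i))])].
Proof.
move=> cA E; exists (insubd state0 (cmd_delta c K r).1); split.
  by rewrite val_insubd states_step // -E; exact: valP.
have nask : otm_ask (conf.1 : tm_state machine) = None by rewrite /= E; case: (c) cA.
rewrite /steps /run /= /oracle_step nask /tm_step /= /machine_delta E -/r.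
by case: (cmd_delta c K r).
Qed.

Lemma at_upd st i w j : nth [::] (set_nth [::] st i w) j = if j == i then w else nth [::] st j :> word.
Proof. by rewrite nth_set_nth. Qed.

Lemma exec_weaken c st m n st' : m <= n -> exec c st m st' -> exec c st n st'.
Proof. by move=> mn H K conf /H[t tm ?]; exists t => //; apply: leq_trans mn. Qed.

Lemma stepsD m n conf : steps (m + n) conf = steps n (steps m conf).
Proof. by rewrite /steps /run addnC iterD. Qed.

Definition stay (t : tape unit) : tape unit := tape_move MStay (tape_write (tape_read t) t).

(** The written symbol is a function of the one read: the identity for [Push], a constant for [Put]
    and [Pop]. *)
Lemma step_act (conf : config machine) c K i (s : sym -> sym) m L :
  c <> Ask -> i < k.+2 -> val conf.1 = c :: K ->
  (forall r : {ffun 'I_k.+2 -> sym}, cmd_delta c K r = (L, act_on i (s (r (inord i))) m r)) ->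
  val (steps 1 conf).1 = L /\ forall j : 'I_k.+2, (steps 1 conf).2 j =
    if val j == i then tape_move m (tape_write (s (tape_read (conf.2 j))) (conf.2 j))
    else stay (conf.2 j).
Proof.
move=> cA ik cE dE.
have [q [qE ->]] := step_state cA cE.
rewrite dE /= in qE *; split=> // j; rewrite !ffunE; case: eqP => [ji|ne] //=.
by rewrite -ji inord_val.
Qed.

Lemma step_no (conf : config machine) c K st L :
  c <> Ask -> at_state conf (c :: K) st ->
  (forall r : {ffun 'I_k.+2 -> sym},
     (forall j : 'I_k.+2, r j = if nth [::] st j is x :: _ then Some (inl x) else None) ->
     cmd_delta c K r = (L, no_act r)) ->
  at_state (steps 1 conf) L st.
Proof.
move=> cA [cE stE] dE.
have [q [qE ->]] := step_state cA cE.
rewrite dE /= in qE *; last by move=> j; rewrite ffunE; exact: represents_read.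
by split=> // j; rewrite !ffunE /=; apply: represents_stay.
Qed.

Lemma exec_push i b st : i < k.+2 ->
  exec (Push i b) st 2 (set_nth [::] st i (b :: nth [::] st i)).
Proof.
move=> ik K conf [cE stE]; exists 2 => //; rewrite (stepsD 1 1).
have [//|//|E1 T1] := step_act (s := id) (m := MLeft) (L := Put i b :: K) _ ik cE.
have [//|//|E2 T2] := step_act (s := fun=> Some (inl b)) (m := MStay) (L := K) _ ik E1.
split=> // j; rewrite at_upd T2 T1; case: eqP => [ji|_].
  by rewrite -ji; exact: represents_push.
exact/represents_stay/represents_stay.
Qed.

Lemma exec_pop i st : i < k.+2 ->
  exec (Pop i) st 1 (set_nth [::] st i (behead (nth [::] st i))).
Proof.
move=> ik K conf [cE stE]; exists 1 => //.
have [//|//|E1 T1] := step_act (s := fun=> None) (m := MRight) (L := K) _ ik cE.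
split=> // j; rewrite at_upd T1; case: eqP => [ji|_].
  by rewrite -ji; exact: represents_pop.
exact/represents_stay.
Qed.

Lemma exec_skip st : exec Skip st 1 st.
Proof. by move=> K conf H; exists 1 => //; apply: step_no H _. Qed.

Lemma exec_seq c1 c2 st n1 st1 n2 st2 :
  exec c1 st n1 st1 -> exec c2 st1 n2 st2 -> exec (Seq c1 c2) st (n1 + n2).+1 st2.
Proof.
move=> H1 H2 K conf H.
have {}H : at_state (steps 1 conf) (c1 :: c2 :: K) st by apply: step_no H _.
have [t1 t1n {}H] := H1 _ _ H.
have [t2 t2n {}H] := H2 _ _ H.
exists (1 + (t1 + t2)); first by rewrite add1n ltnS leq_add.
by rewrite !stepsD.
Qed.

Lemma exec_case i c0 c1 c2 st n st' : i < k.+2 ->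
  exec (match nth [::] st i with [::] => c0 | b :: _ => if b then c2 else c1 end) st n st' ->
  exec (Case i c0 c1 c2) st n.+1 st'.
Proof.
move=> ik H1 K conf H.
have {}H : at_state (steps 1 conf)
    ((match nth [::] st i with [::] => c0 | b :: _ => if b then c2 else c1 end) :: K) st.
  by apply: step_no H _ => // r rE; rewrite /= rE inordK //; case: (nth _ _ _).
have [t tn {}H] := H1 _ _ H.
by exists (1 + t) => //; rewrite stepsD.
Qed.

Lemma exec_while_nil i c st : i < k.+2 -> nth [::] st i = [::] -> exec (While i c) st 1 st.
Proof.
move=> ik E K conf H; exists 1 => //.
by apply: step_no H _ => // r rE; rewrite /= rE inordK // E.
Qed.

Lemma exec_while_cons i c st n1 st1 n2 st2 : i < k.+2 -> nth [::] st i != [::] ->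
  exec c st n1 st1 -> exec (While i c) st1 n2 st2 -> exec (While i c) st (n1 + n2).+1 st2.
Proof.
move=> ik E H1 H2 K conf H.
have {}H : at_state (steps 1 conf) (c :: While i c :: K) st.
  by apply: step_no H _ => // r rE; rewrite /= rE inordK //; move: E; case: (nth _ _ _).
have [t1 t1n {}H] := H1 _ _ H.
have [t2 t2n {}H] := H2 _ _ H.
exists (1 + (t1 + t2)); first by rewrite add1n ltnS leq_add.
by rewrite !stepsD.
Qed.

Lemma represents_word t w : represents t w -> word_of_tape t = w.
Proof.
move=> [a [b ->]]; rewrite /word_of_tape /=.
by elim: w => [|x w /= ->] //=; case: b.
Qed.

Lemma represents_tape w : represents (tape_of_word unit w) w.
Proof. by exists 0, 0; rewrite cats0. Qed.

Lemma exec_ask st : exec Ask st 1 (set_nth [::] st 1 (O (nth [::] st 1))).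
Proof.
move=> K conf [cE stE]; exists 1 => //.
(* The query step bypasses [cmd_delta], but has the continuation that [cmd_delta] assigns to [Ask],
   so the closure of [states] applies. *)
have KS : K \in states by apply: (@states_step Ask K [ffun=> None]); rewrite -cE; exact: valP.
have -> : steps 1 conf = (insubd state0 K, [ffun i : 'I_k.+2 => if i == oracle_tape k
    then tape_of_word unit (O (word_of_tape (conf.2 i))) else conf.2 i]).
  by rewrite /steps /run /= /oracle_step /= cE.
split=> /=; first by rewrite val_insubd KS.
move=> j; rewrite at_upd ffunE -val_eqE /=; case: eqP => // j1.
by rewrite (represents_word (stE j)) j1; exact: represents_tape.
Qed.

(** The empty continuation halts, and a halted configuration is unchanged up to time exactly [n]. *)
Lemma exec_computes st n st' x v :
  (forall j, nth [::] st j = if j == 0 then x else [::]) ->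
  exec prog st n st' -> nat_of_word (nth [::] st' 0) = v ->
  oracle_computes_within machine O x n v.
Proof.
move=> stE H <-.
have [|t tn [cE st'E]] := H [::] (oracle_start machine x).
  split=> // j; rewrite ffunE stE (_ : (j == _) = (val j == 0)) //.
  exact: represents_tape.
have halt : halted (oracle_step (N := machine) O) (steps t (oracle_start machine x)).
  have nask : otm_ask (steps t (oracle_start machine x)).1 = None by rewrite /= cE.
  by rewrite /halted /oracle_step nask /tm_step /= /machine_delta cE.
rewrite /oracle_computes_within -(subnKC tn) -/(steps _ _) stepsD.
have -> : steps (n - t) (steps t (oracle_start machine x)) = steps t (oracle_start machine x).
  rewrite /steps /run; elim: (n - t) => // m IH; rewrite iterS IH -/(run _ _ _) -/(steps _ _).
  by rewrite halt.
split=> //; congr nat_of_word; exact: represents_word (st'E ord0).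
Qed.

End Machine.

(** * Polynomial-time triples *)

Record param := Param {
  par :> Type;
  par_oracle : par -> word -> word;
  par_size : par -> nat;
  par_ok : par -> Prop
}.
Arguments par_ok {p0} _ : rename.
Arguments par_size {p0} _ : rename.
Arguments par_oracle {p0} _ _ : rename.

Definition poly_bounded (A : param) (m : A -> nat) : Prop :=
  exists p : {poly nat}, forall a, par_ok a -> m a <= (horner p (par_size a)).

(* The bound is chosen before the oracle, which is part of the parameter a. *)
Definition pexec (A : param) (c : cmd) (S S' : A -> store) : Prop :=
  exists p : {poly nat}, forall prog a, par_ok a ->
    exec 6 prog (par_oracle a) c (S a) (horner p (par_size a)) (S' a).

(** The index of an iteration becomes part of the parameter while the size stays, so the body gets
    one bound valid for all iterations. [par_sub] does the same for the condition of a branch. *)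
Definition par_loop (A : param) (m : A -> nat) : param :=
  @Param (A * nat) (fun z => par_oracle z.1) (fun z => par_size z.1)
    (fun z => par_ok z.1 /\ z.2 < m z.1).
Definition par_sub (A : param) (P : A -> Prop) : param :=
  @Param A par_oracle par_size (fun a => par_ok a /\ P a).

Section Bounds.
Variable A : param.
Implicit Types m n : A -> nat.

Lemma poly_boundedW m n : (forall a, par_ok a -> m a <= n a) -> poly_bounded n -> poly_bounded m.
Proof. by move=> mn [p np]; exists p => a oka; apply: leq_trans (mn a oka) (np a oka). Qed.

Lemma poly_bounded_cst c : poly_bounded (fun _ : A => c).
Proof. by exists (polyC c) => a _; rewrite hornerC. Qed.

Lemma poly_boundedD m n : poly_bounded m -> poly_bounded n -> poly_bounded (fun a => m a + n a).
Proof.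
move=> [p mp] [q nq]; exists (p + q)%R => a oka; rewrite hornerD.
by apply: leq_add; [exact: mp|exact: nq].
Qed.

Lemma poly_boundedM m n : poly_bounded m -> poly_bounded n -> poly_bounded (fun a => m a * n a).
Proof.
move=> [p mp] [q nq]; exists (p * q)%R => a oka; rewrite hornerM.
by apply: leq_mul; [exact: mp|exact: nq].
Qed.

Lemma poly_bounded_horner (p : {poly nat}) m : poly_bounded m -> poly_bounded (fun a => horner p (m a)).
Proof.
move=> mb; rewrite /horner; elim: (p : seq nat) => [|c s IH] /=; first exact: poly_bounded_cst.
by apply: poly_boundedD (poly_bounded_cst c); apply: poly_boundedM.
Qed.

Lemma poly_bounded_loop m n : poly_bounded n -> poly_bounded (A := par_loop m) (fun z => n z.1).
Proof. by move=> [p np]; exists p => -[a j] [oka _]; exact: np. Qed.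

Lemma poly_bounded_index m : poly_bounded m -> poly_bounded (A := par_loop m) (fun z => z.2).
Proof. by move=> [p np]; exists p => -[a j] [oka /ltnW jm]; apply: leq_trans jm (np a oka). Qed.

Lemma poly_bounded_sub (P : A -> Prop) m : poly_bounded m -> poly_bounded (A := par_sub P) m.
Proof. by move=> [p np]; exists p => a [oka _]; exact: np. Qed.
End Bounds.

Section Rules.
Variable A : param.
Implicit Types S : A -> store.

Lemma pexec_eq c S S' R R' : pexec c S S' ->
  (forall a, par_ok a -> S a = R a) -> (forall a, par_ok a -> S' a = R' a) -> pexec c R R'.
Proof. by move=> [p H] E E'; exists p => prog a oka; rewrite -E // -E' //; exact: H. Qed.

Lemma pexec_post c S S' R' : pexec c S S' ->
  (forall a, par_ok a -> S' a = R' a) -> pexec c S R'.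
Proof. by move=> H E; apply: pexec_eq H _ E. Qed.

Lemma pexec_push i b S : i < 8 ->
  pexec (Push i b) S (fun a => set_nth [::] (S a) i (b :: nth [::] (S a) i)).
Proof. by move=> i8; exists (polyC 2) => prog a _; rewrite hornerC; apply: exec_push. Qed.

Lemma pexec_pop i S : i < 8 ->
  pexec (Pop i) S (fun a => set_nth [::] (S a) i (behead (nth [::] (S a) i))).
Proof. by move=> i8; exists (polyC 1) => prog a _; rewrite hornerC; apply: exec_pop. Qed.

Lemma pexec_skip S : pexec Skip S S.
Proof. by exists (polyC 1) => prog a _; rewrite hornerC; apply: exec_skip. Qed.

Lemma pexec_ask S :
  pexec Ask S (fun a => set_nth [::] (S a) 1 (par_oracle a (nth [::] (S a) 1))).
Proof. by exists (polyC 1) => prog a _; rewrite hornerC; apply: exec_ask. Qed.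

Lemma pexec_seq c1 c2 S S1 S2 : pexec c1 S S1 -> pexec c2 S1 S2 -> pexec (Seq c1 c2) S S2.
Proof.
move=> [p1 H1] [p2 H2]; exists (p1 + p2 + polyC 1)%R => prog a oka.
rewrite !hornerD hornerC; apply: exec_weaken (exec_seq (H1 prog a oka) (H2 prog a oka)).
by rewrite addrC.
Qed.

Lemma pexec_case i c0 c1 c2 S S' : i < 8 ->
  pexec (A := par_sub (fun a => nth [::] (S a) i = [::])) c0 S S' ->
  pexec (A := par_sub (fun a => exists w, nth [::] (S a) i = false :: w)) c1 S S' ->
  pexec (A := par_sub (fun a => exists w, nth [::] (S a) i = true :: w)) c2 S S' ->
  pexec (Case i c0 c1 c2) S S'.
Proof.
move=> i8 [p0 H0] [p1 H1] [p2 H2]; exists (p0 + p1 + p2 + polyC 1)%R => prog a oka.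
rewrite !hornerD hornerC; set m := (horner p0 _ + _ + _)%R.
apply: (@exec_weaken _ _ _ _ _ m.+1); first by rewrite addrC.
apply: exec_case => //; case E: (nth [::] (S a) i) => [|[|] w].
- by apply: exec_weaken (H0 prog a (conj oka E)); rewrite /m -addrA leq_addr.
- apply: exec_weaken (H2 prog a (conj oka (ex_intro _ w E))); exact: leq_addl.
- apply: exec_weaken (H1 prog a (conj oka (ex_intro _ w E))).
  by rewrite /m addrAC; exact: leq_addl.
Qed.

Lemma pexec_while i c (m : A -> nat) (S : A -> nat -> store) : i < 8 -> poly_bounded m ->
  (forall a j, par_ok a -> j < m a -> nth [::] (S a j) i != [::]) ->
  (forall a, par_ok a -> nth [::] (S a (m a)) i = [::]) ->
  pexec (A := par_loop m) c (fun z => S z.1 z.2) (fun z => S z.1 z.2.+1) ->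
  pexec (While i c) (fun a => S a 0) (fun a => S a (m a)).
Proof.
move=> i8 [q mq] Sne Se [p H]; exists (q * (p + polyC 1) + polyC 1)%R => prog a oka.
rewrite !(hornerD, hornerM, hornerC).
(* [d] counts the iterations still to come. *)
have HL d : d <= m a -> exec 6 prog (par_oracle a) (While i c) (S a (m a - d))
    (d * ((horner p (par_size a)) + 1) + 1) (S a (m a)).
  elim: d => [|d IH] dm.
    by rewrite subn0 mul0n; apply: exec_while_nil => //; exact: Se.
  have jm : m a - d.+1 < m a by lia.
  have {}IH := IH (ltnW dm).
  have H1 := H prog (a, m a - d.+1) (conj oka jm).
  rewrite /= -subSn // subSS in H1.
  apply: exec_weaken (exec_while_cons _ (Sne _ _ oka jm) H1 IH) => //.
  by rewrite mulSn; lia.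
have := HL (m a) (leqnn _); rewrite subnn; apply: exec_weaken.
by apply: leq_add => //; apply: leq_mul => //; exact: mq.
Qed.

End Rules.

Definition Loop i c := While i (Seq (Pop i) c).

(** The invariant fixes the counter; the body starts with one unit already popped. *)
Lemma pexec_loop (A : param) i c (m : A -> nat) (S : A -> nat -> store) : i < 8 -> poly_bounded m ->
  (forall a j, par_ok a -> j <= m a -> nth [::] (S a j) i = nseq (m a - j) true) ->
  pexec (A := par_loop m) c (fun z => set_nth [::] (S z.1 z.2) i (nseq (m z.1 - z.2.+1) true))
    (fun z => S z.1 z.2.+1) ->
  pexec (Loop i c) (fun a => S a 0) (fun a => S a (m a)).
Proof.
move=> i8 mb SE H; apply: pexec_while => //.
- by move=> a j oka jm; rewrite SE ?(ltnW jm) //; case E: (m a - j) => [|d] //; lia.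
- by move=> a oka; rewrite SE // subnn.
apply: pexec_seq; first exact: pexec_pop.
apply: pexec_eq H _ _ => // -[a j] [/= oka jm].
by rewrite SE ?(ltnW jm) // -(subnSK jm).
Qed.

(** * Programs that write the constraints *)

Definition unary (v : nat) : word := nseq v true.
(* Registers: input, output, two scratch registers, input length, accumulator, base of
   the current cell, distance D.  Numbers are in unary; the output is built from its
   end, since pushing extends it to the left. *)
Notation regs i o t1 t2 n c b d := [:: i; o; t1; t2; n; c; b; d] (only parsing).

Fixpoint PushWord (i : nat) (w : word) : cmd :=
  if w is x :: w' then Seq (PushWord i w') (Push i x) else Skip.

Lemma pexec_push_word (A : param) i w (S : A -> store) : i < 8 ->
  (forall a, par_ok a -> i < size (S a)) ->
  pexec (PushWord i w) S (fun a => set_nth [::] (S a) i (w ++ nth [::] (S a) i)).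
Proof.
move=> i8 sS; elim: w => [|x w IH] /=.
  apply: pexec_eq (pexec_skip S) _ _ => // a /sS iS.
  apply: (@eq_from_nth _ [::]) => [|j jS]; first by rewrite size_set_nth; apply/esym/maxn_idPr.
  by rewrite nth_set_nth /=; case: eqP => [->|].
apply: pexec_eq (pexec_seq IH (pexec_push _ _ i8)) _ _ => // a /sS iS.
by rewrite nth_set_nth /= eqxx set_set_nth eqxx.
Qed.

Arguments PushWord : simpl never.

(** Each unit yields two bits because the constant 1^v is encoded by 1^(2v) 0. Register 2 keeps a
    copy, from which [r] is restored. *)
Definition EmitReg (r : nat) : cmd :=
  Seq (Loop r (Seq (Push 2 true) (Seq (Push 1 true) (Push 1 true)))) (Loop 2 (Push r true)).

(** The layout [L] exposes registers 1, 2 and [r], so that one proof serves for registers 5, 6 and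
    7. *)
Lemma pexec_emit_reg (A : param) r (L : A -> word -> word -> word -> store) (v : A -> nat) (o : A -> word) :
  r < 8 -> poly_bounded v ->
  (forall a x y z, [/\ nth [::] (L a x y z) 1 = x, nth [::] (L a x y z) 2 = y & nth [::] (L a x y z) r = z]) ->
  (forall a x y z w, [/\ set_nth [::] (L a x y z) 1 w = L a w y z,
     set_nth [::] (L a x y z) 2 w = L a x w z & set_nth [::] (L a x y z) r w = L a x y w]) ->
  pexec (EmitReg r) (fun a => L a (o a) [::] (unary (v a)))
    (fun a => L a (nseq (v a).*2 true ++ o a) [::] (unary (v a))).
Proof.
move=> r8 vb nthL setL.
have n1 a x y z : nth [::] (L a x y z) 1 = x by case: (nthL a x y z).
have n2 a x y z : nth [::] (L a x y z) 2 = y by case: (nthL a x y z).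
have nr a x y z : nth [::] (L a x y z) r = z by case: (nthL a x y z).
have s1 a x y z w : set_nth [::] (L a x y z) 1 w = L a w y z by case: (setL a x y z w).
have s2 a x y z w : set_nth [::] (L a x y z) 2 w = L a x w z by case: (setL a x y z w).
have sr a x y z w : set_nth [::] (L a x y z) r w = L a x y w by case: (setL a x y z w).
apply: (pexec_seq (S1 := fun a => L a (nseq (v a).*2 true ++ o a) (unary (v a)) [::])).
  pose S a j := L a (nseq j.*2 true ++ o a) (unary j) (unary (v a - j)).
  apply: pexec_eq (pexec_loop (S := S) (m := v) (i := r) _ _ _ _) _ _ => //.
  - by move=> a j _ _; rewrite nr.
  - apply: pexec_seq; first exact: pexec_push.
    apply: pexec_seq; first exact: pexec_push.
    apply: pexec_post; first exact: pexec_push.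
    by move=> [a j] _; rewrite /S doubleS !(n1, n2, nr, s1, s2, sr).
  - by move=> a _; rewrite /S subn0.
  - by move=> a _; rewrite /S subnn.
pose S a j := L a (nseq (v a).*2 true ++ o a) (unary (v a - j)) (unary j).
apply: pexec_eq (pexec_loop (S := S) (m := v) (i := 2) _ _ _ _) _ _ => //.
- by move=> a j _ _; rewrite n2.
- apply: pexec_post; first exact: pexec_push.
  by move=> [a j] _; rewrite /S !(n1, n2, nr, s1, s2, sr).
- by move=> a _; rewrite /S subn0.
- by move=> a _; rewrite /S subnn.
Qed.

Definition enc_lit (l : literal) : word :=
  true :: l.2 :: enc_matom (matom_of_gmatom (gatom l.1)).
Definition enc_lits (t : seq literal) : word := flatten [seq enc_lit l | l <- t] ++ [:: false].
(** The tag of a concept assertion, the tag of an atomic concept, and the empty names of the concept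
    and of the individual. *)
Definition enc_goal : word := false :: enc_nat 3 ++ [:: false; false].
Definition enc_terms (F : seq (seq literal)) : word :=
  flatten [seq true :: enc_goal ++ enc_lits t | t <- F].

Lemma enc_cname v : enc_name (cname v) = nseq v.*2 true ++ [:: false].
Proof.
rewrite /enc_name /enc_seq; congr (_ ++ _).
by elim: v => // v IH; rewrite doubleS /= -IH.
Qed.

Arguments enc_lit : simpl never.
Arguments enc_terms : simpl never.
Arguments enc_goal : simpl never.

(** Written backwards: the ends of the constant and of the argument list, the index, then list mark,
    sign, empty predicate name, list mark and constant tag. The index is a sum formed by
    concatenating unary parts. *)
Definition EmitLit (l : bool * nat * bool) : cmd :=
  Seq (PushWord 1 [:: false; false]) (Seq (PushWord 1 (nseq l.1.2.*2 true))
  (Seq (EmitReg 6) (Seq (if l.1.1 then EmitReg 7 else Skip)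
  (PushWord 1 [:: true; l.2; false; true; true])))).
Fixpoint EmitLits (tm : template) : cmd :=
  if tm is l :: tm' then Seq (EmitLits tm') (EmitLit l) else Skip.
Definition EmitTerm (tm : template) : cmd :=
  Seq (Push 1 false) (Seq (EmitLits tm) (PushWord 1 (true :: enc_goal))).
Fixpoint EmitTerms (B : seq template) : cmd :=
  if B is tm :: B' then Seq (EmitTerms B') (EmitTerm tm) else Skip.
Definition Block (l : nat) (B : seq template) : cmd :=
  Seq (EmitTerms B) (PushWord 6 (nseq l true)).

Section Emit.
Variables (A : param) (i n c : A -> word) (b d : A -> nat).
Hypotheses (bb : poly_bounded b) (db : poly_bounded d).
Notation st o := (fun a => regs (i a) (o a) [::] [::] (n a) (c a) (unary (b a)) (unary (d a))).

Lemma pexec_emit_lit l (o : A -> word) : pexec (EmitLit l) (st o)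
  (st (fun a => enc_lit ((if l.1.1 then d a + b a + l.1.2 else b a + l.1.2), l.2) ++ o a)).
Proof.
case: l => [[isD off] val] /=.
apply: pexec_seq; first exact: pexec_push_word.
apply: pexec_seq; first exact: pexec_push_word.
rewrite /=; apply: pexec_seq.
  by apply: (pexec_emit_reg (r := 6) (L := fun a x y z => regs (i a) x y [::] (n a) (c a) z (unary (d a)))).
apply: (pexec_seq (S1 := st (fun a => nseq (if isD then d a + b a + off else b a + off).*2 true ++ [:: false; false] ++ o a))).
  have E a : nseq (b a).*2 true ++ nseq off.*2 true ++ [:: false, false & o a] =
     nseq (b a + off).*2 true ++ [:: false, false & o a] by rewrite doubleD nseqD catA.
  case: isD; last by apply: pexec_post (pexec_skip _) _ => a _; rewrite E.
  apply: pexec_post.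
    by apply: (pexec_emit_reg (r := 7) (L := fun a x y z => regs (i a) x y [::] (n a) (c a) (unary (b a)) z)).
  by move=> a _; rewrite /= E -!addnA [in RHS]doubleD nseqD -catA.
apply: pexec_post; first exact: pexec_push_word.
by move=> a _; rewrite /= enc_cname cats0 -!catA.
Qed.

Lemma pexec_emit_lits tm (o : A -> word) : pexec (EmitLits tm) (st o)
  (st (fun a => flatten [seq enc_lit l | l <- inst (b a) (d a) tm] ++ o a)).
Proof.
elim: tm => [|l tm IH] /=; first exact: pexec_skip.
apply: pexec_seq IH _; apply: pexec_post; first exact: pexec_emit_lit.
by move=> a _; rewrite /= catA.
Qed.

Lemma pexec_emit_term tm F (o : A -> word) : pexec (EmitTerm tm) (st (fun a => enc_terms (F a) ++ o a))
  (st (fun a => enc_terms (inst (b a) (d a) tm :: F a) ++ o a)).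
Proof.
apply: pexec_seq; first exact: pexec_push.
rewrite /=; apply: pexec_seq; first exact: pexec_emit_lits.
apply: pexec_post; first exact: pexec_push_word.
by move=> a _; rewrite /enc_terms /= /enc_lits -!catA.
Qed.

Lemma pexec_emit_terms B F (o : A -> word) : pexec (EmitTerms B) (st (fun a => enc_terms (F a) ++ o a))
  (st (fun a => enc_terms ([seq inst (b a) (d a) tm | tm <- B] ++ F a) ++ o a)).
Proof.
elim: B => [|tm B IH] /=; first exact: pexec_skip.
by apply: pexec_seq IH _; apply: pexec_emit_term.
Qed.

Lemma pexec_block l B F (o : A -> word) : pexec (Block l B) (st (fun a => enc_terms (F a) ++ o a))
  (fun a => regs (i a) (enc_terms ([seq inst (b a) (d a) tm | tm <- B] ++ F a) ++ o a) [::] [::] (n a) (c a)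
     (unary (b a + l)) (unary (d a))).
Proof.
apply: pexec_seq; first exact: pexec_emit_terms.
apply: pexec_post; first exact: pexec_push_word.
by move=> a _; rewrite /= /unary addnC nseqD.
Qed.
End Emit.

Section Program.
Variable V : tm 1.
Notation l := (code_size V).
Notation cell_block := (@cell_block V).

Lemma instances_cat D b (s1 s2 : seq (seq template)) F :
  instances V D b (s1 ++ s2) F = instances V D (b + size s1 * l) s2 (instances V D b s1 F).
Proof.
elim: s1 b F => [|B s1 IH] b F /=; first by rewrite addn0.
by rewrite IH mulSn addnA.
Qed.

(** Peels off the last copy, the one that an iteration of the loop adds. *)
Lemma instances_nseqS D b j B F :
  instances V D b (nseq j.+1 B) F =
  [seq inst (b + j * l) D tm | tm <- B] ++ instances V D b (nseq j B) F.
Proof.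
by rewrite -addn1 nseqD instances_cat size_nseq.
Qed.

Section Rows.
Variables (A : param) (n : A -> word) (b d : A -> nat) (F : A -> seq (seq literal)) (o : A -> word).
Hypotheses (bb : poly_bounded b) (db : poly_bounded d).

Lemma pexec_blocks i B (m : A -> nat) : poly_bounded m ->
  pexec (Loop 5 (Block l B))
    (fun a => regs (i a) (enc_terms (F a) ++ o a) [::] [::] (n a) (unary (m a)) (unary (b a)) (unary (d a)))
    (fun a => regs (i a) (enc_terms (instances V (d a) (b a) (nseq (m a) B) (F a)) ++ o a) [::] [::] (n a) [::]
      (unary (b a + m a * l)) (unary (d a))).
Proof.
move=> mb.
pose S a j := regs (i a) (enc_terms (instances V (d a) (b a) (nseq j B) (F a)) ++ o a) [::] [::] (n a)
  (unary (m a - j)) (unary (b a + j * l)) (unary (d a)).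
apply: pexec_eq (pexec_loop (S := S) (m := m) (i := 5) _ _ _ _) _ _ => //.
- apply: pexec_post.
    apply: (@pexec_block (par_loop m) (fun z => i z.1) (fun z => n z.1) (fun z => unary (m z.1 - z.2.+1))
      (fun z => b z.1 + z.2 * l) (fun z => d z.1) _ _ l B
      (fun z => instances V (d z.1) (b z.1) (nseq z.2 B) (F z.1)) (fun z => o z.1)).
      apply: poly_boundedD; first exact: poly_bounded_loop.
      by apply: poly_boundedM; [exact: poly_bounded_index|exact: poly_bounded_cst].
    exact: poly_bounded_loop.
  by move=> [a j] _; rewrite /S [fst _]/= [snd _]/= instances_nseqS mulSn addnAC addnA.
- by move=> a _; rewrite /S subn0 addn0.
- by move=> a _; rewrite /S subnn.
Qed.

Definition input_blocks (x : word) : seq (seq template) :=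
  flatten [seq [:: cell_block (bit_cell V b); cell_block (bit_cell V b)] | b <- x].

Definition EmitInput : cmd :=
  While 0 (Case 0 Skip
    (Seq (Pop 0) (Seq (Block l (cell_block (bit_cell V false))) (Block l (cell_block (bit_cell V false)))))
    (Seq (Pop 0) (Seq (Block l (cell_block (bit_cell V true))) (Block l (cell_block (bit_cell V true)))))).

Lemma size_input_blocks x : size (input_blocks x) = (size x).*2.
Proof. by rewrite /input_blocks; elim: x => //= y x ->; rewrite doubleS. Qed.

Lemma pexec_input (x : A -> word) c : poly_bounded (fun a => size (x a)) ->
  pexec EmitInput
    (fun a => regs (x a) (enc_terms (F a) ++ o a) [::] [::] (n a) (c a) (unary (b a)) (unary (d a)))
    (fun a => regs [::] (enc_terms (instances V (d a) (b a) (input_blocks (x a)) (F a)) ++ o a) [::] [::] (n a) (c a)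
      (unary (b a + (size (x a)).*2 * l)) (unary (d a))).
Proof.
move=> mb.
pose S a j := regs (drop j (x a)) (enc_terms (instances V (d a) (b a) (input_blocks (take j (x a))) (F a)) ++ o a)
  [::] [::] (n a) (c a) (unary (b a + j.*2 * l)) (unary (d a)).
apply: pexec_eq (pexec_while (S := S) (m := fun a => size (x a)) (i := 0) _ _ _ _ _) _ _ => //.
- move=> a j _ jx; rewrite /S /=; apply/eqP => /(congr1 size); rewrite size_drop /=; lia.
- by move=> a _; rewrite /S /= drop_size.
- have H y : pexec (A := par_sub (A := par_loop (A := A) (fun a => size (x a)))
      (fun z => exists w, nth [::] (S z.1 z.2) 0 = y :: w))
    (Seq (Pop 0) (Seq (Block l (cell_block (bit_cell V y))) (Block l (cell_block (bit_cell V y)))))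
    (fun z => S z.1 z.2) (fun z => S z.1 z.2.+1).
    set A' := par_sub _.
    have bb' : poly_bounded (A := A') (fun z => b z.1 + z.2.*2 * l).
      apply/poly_bounded_sub/poly_boundedD; first exact: poly_bounded_loop.
      apply: poly_boundedM; last exact: poly_bounded_cst.
      apply: poly_boundedW (poly_boundedM (poly_bounded_cst _ 2) (poly_bounded_index mb)) => -[a j] _ /=.
      by rewrite mul2n.
    have db' : poly_bounded (A := A') (fun z => d z.1) by apply/poly_bounded_sub/poly_bounded_loop.
    apply: pexec_seq; first exact: pexec_pop.
    rewrite /S /=; apply: pexec_seq.
      exact: (@pexec_block A' (fun z => behead (drop z.2 (x z.1))) (fun z => n z.1) (fun z => c z.1)
        (fun z => b z.1 + z.2.*2 * l) (fun z => d z.1) bb' db' l (cell_block (bit_cell V y))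
        (fun z => instances V (d z.1) (b z.1) (input_blocks (take z.2 (x z.1))) (F z.1)) (fun z => o z.1)).
    apply: pexec_post.
      apply: (@pexec_block A' (fun z => behead (drop z.2 (x z.1))) (fun z => n z.1) (fun z => c z.1)
        (fun z => b z.1 + z.2.*2 * l + l) (fun z => d z.1) _ db' l (cell_block (bit_cell V y))
        (fun z => [seq inst (b z.1 + z.2.*2 * l) (d z.1) tm | tm <- cell_block (bit_cell V y)] ++
          instances V (d z.1) (b z.1) (input_blocks (take z.2 (x z.1))) (F z.1)) (fun z => o z.1)).
      by apply: poly_boundedD => //; exact: poly_bounded_cst.
    move=> [a j] [[/= oka jx] [w]] Ew.
    have Ed : drop j.+1 (x a) = w by rewrite -add1n -drop_drop Ew /= drop0.
    have Et : take j.+1 (x a) = rcons (take j (x a)) y.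
      rewrite (take_nth false) //; congr rcons.
      by rewrite -[j]addn0 -nth_drop Ew.
    rewrite Ed Ew Et /input_blocks map_rcons -cats1 flatten_cat instances_cat.
    rewrite -/(input_blocks _) size_input_blocks size_take jx /=.
    by rewrite doubleS !mulSn; congr [:: _; _; _; _; _; _; unary _; _]; lia.
  apply: pexec_case => //.
  have [p _] := mb; exists 0%R => prog -[a j] [[/= oka jx] Ed].
  by move/(congr1 size): Ed; rewrite size_drop /=; lia.
- by move=> a _; rewrite /S drop0 take0 addn0.
- by move=> a _; rewrite /S drop_size take_size.
Qed.
End Rows.
End Program.

(** * Unary arithmetic and the remaining parts of the query *)

Lemma pexec_move (A : param) r s (L : A -> word -> word -> store) (v : A -> nat) (y : A -> word) :
  r < 8 -> s < 8 -> poly_bounded v ->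
  (forall a x z, nth [::] (L a x z) r = x /\ nth [::] (L a x z) s = z) ->
  (forall a x z w, set_nth [::] (L a x z) r w = L a w z /\ set_nth [::] (L a x z) s w = L a x w) ->
  pexec (Loop r (Push s true)) (fun a => L a (unary (v a)) (y a)) (fun a => L a [::] (unary (v a) ++ y a)).
Proof.
move=> r8 s8 vb nthL setL.
pose S a j := L a (unary (v a - j)) (unary j ++ y a).
apply: pexec_eq (pexec_loop (S := S) (m := v) (i := r) _ _ _ _) _ _ => //.
- by move=> a j _ _; case: (nthL a (unary (v a - j)) (unary j ++ y a)).
- apply: pexec_post; first exact: pexec_push.
  move=> [a j] _; rewrite /S (proj1 (setL _ _ _ _)) (proj2 (setL _ _ _ _)).
  by rewrite (proj2 (nthL _ _ _)).
- by move=> a _; rewrite /S subn0.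
- by move=> a _; rewrite /S subnn.
Qed.

Definition Clear (r : nat) : cmd := Loop r Skip.

Lemma pexec_clear (A : param) r (L : A -> word -> store) (v : A -> nat) :
  r < 8 -> poly_bounded v -> (forall a x, nth [::] (L a x) r = x) ->
  (forall a x w, set_nth [::] (L a x) r w = L a w) ->
  pexec (Clear r) (fun a => L a (unary (v a))) (fun a => L a [::]).
Proof.
move=> r8 vb nthL setL.
apply: pexec_eq (pexec_loop (S := fun a j => L a (unary (v a - j))) (m := v) (i := r) _ _ _ _) _ _ => //.
- by apply: pexec_post (pexec_skip _) _ => -[a j] _; rewrite setL.
- by move=> a _; rewrite subn0.
- by move=> a _; rewrite subnn.
Qed.

(** Repeated addition: for every unit of register 5, register 4 is copied into register 3 and
    restored from register 2. *)
Definition Mul : cmd :=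
  Seq (Loop 5 (Seq (Loop 4 (Seq (Push 2 true) (Push 3 true))) (Loop 2 (Push 4 true))))
      (Loop 3 (Push 5 true)).

Fixpoint Horner (s : seq nat) : cmd :=
  if s is c :: s' then Seq (Horner s') (Seq Mul (PushWord 5 (unary c))) else Skip.

Section Horner.
Variables (A : param) (i o : A -> word) (n : A -> nat) (b d : A -> word).
Hypothesis nb : poly_bounded n.

Lemma pexec_mul (v : A -> nat) : poly_bounded v ->
  pexec Mul
    (fun a => regs (i a) (o a) [::] [::] (unary (n a)) (unary (v a)) (b a) (d a))
    (fun a => regs (i a) (o a) [::] [::] (unary (n a)) (unary (v a * n a)) (b a) (d a)).
Proof.
move=> vb; apply: (pexec_seq (S1 := fun a =>
  regs (i a) (o a) [::] (unary (v a * n a)) (unary (n a)) [::] (b a) (d a))).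
  pose S a j := regs (i a) (o a) [::] (unary (j * n a)) (unary (n a)) (unary (v a - j)) (b a) (d a).
  apply: pexec_eq (pexec_loop (S := S) (m := v) (i := 5) _ _ _ _) _ _ => //.
  - pose A' := par_loop v.
    apply: (pexec_seq (S1 := fun z : A' => regs (i z.1) (o z.1) (unary (n z.1)) (unary (z.2.+1 * n z.1)) [::]
       (unary (v z.1 - z.2.+1)) (b z.1) (d z.1))).
      pose S' (z : A') j := regs (i z.1) (o z.1) (unary j) (unary (j + z.2 * n z.1)) (unary (n z.1 - j))
        (unary (v z.1 - z.2.+1)) (b z.1) (d z.1).
      apply: pexec_eq (pexec_loop (A := A') (S := S') (m := fun z => n z.1) (i := 4) _ _ _ _) _ _ => //.
      + exact: (poly_bounded_loop v nb).
      + apply: pexec_seq; first exact: pexec_push.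
        by apply: pexec_post; first exact: pexec_push.
      + by move=> z _; rewrite /S' subn0.
      + by move=> z _; rewrite /S' subnn mulSn.
    apply: pexec_post.
      apply: (pexec_move (A := A') (r := 2) (s := 4) (L := fun z x y => regs (i z.1) (o z.1) x (unary (z.2.+1 * n z.1)) y
        (unary (v z.1 - z.2.+1)) (b z.1) (d z.1)) (v := fun z => n z.1)) => //.
      exact: (poly_bounded_loop v nb).
    by move=> z _; rewrite /= cats0.
  - by move=> a _; rewrite /S subn0.
  - by move=> a _; rewrite /S subnn.
apply: pexec_post.
  apply: (pexec_move (r := 3) (s := 5) (L := fun a x y => regs (i a) (o a) [::] x (unary (n a)) y (b a) (d a))
    (v := fun a => v a * n a)) => //.
  exact: poly_boundedM.
by move=> a _; rewrite /= cats0.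
Qed.

Lemma pexec_horner (p : {poly nat}) :
  pexec (Horner p)
    (fun a => regs (i a) (o a) [::] [::] (unary (n a)) [::] (b a) (d a))
    (fun a => regs (i a) (o a) [::] [::] (unary (n a)) (unary (horner p (n a))) (b a) (d a)).
Proof.
(* The intermediate values have to be bounded along with the induction, as they control the loops of
   [Mul]. *)
suff H (s : seq nat) : pexec (Horner s)
    (fun a => regs (i a) (o a) [::] [::] (unary (n a)) [::] (b a) (d a))
    (fun a => regs (i a) (o a) [::] [::] (unary (n a)) (unary (horner_rec s (n a))) (b a) (d a)) /\
    poly_bounded (fun a => horner_rec s (n a)) by exact: (H p).1.
elim: s => [|c s [IH Hb]] /=.
  by split; [exact: pexec_skip|exact: poly_bounded_cst].
split; last by apply: poly_boundedD (poly_boundedM Hb nb) (poly_bounded_cst _ c).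
apply: pexec_seq IH _; apply: pexec_seq; first exact: pexec_mul.
apply: pexec_post; first exact: pexec_push_word.
by move=> a _; rewrite /= /unary -nseqD addnC.
Qed.
End Horner.

Definition Measure : cmd :=
  Seq (While 0 (Case 0 Skip (Seq (Pop 0) (Seq (Push 3 false) (Push 4 true)))
                            (Seq (Pop 0) (Seq (Push 3 true) (Push 4 true)))))
      (While 3 (Case 3 Skip (Seq (Pop 3) (Push 0 false)) (Seq (Pop 3) (Push 0 true)))).

Lemma pexec_measure (A : param) (x : A -> word) : poly_bounded (fun a => size (x a)) ->
  pexec Measure (fun a => regs (x a) [::] [::] [::] [::] [::] [::] [::])
    (fun a => regs (x a) [::] [::] [::] (unary (size (x a))) [::] [::] [::]).
Proof.
move=> mb; apply: (pexec_seq (S1 := fun a => regs [::] [::] [::] (rev (x a)) (unary (size (x a))) [::] [::] [::])).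
  pose S a j := regs (drop j (x a)) [::] [::] (rev (take j (x a))) (unary j) [::] [::] [::].
  apply: pexec_eq (pexec_while (S := S) (m := fun a => size (x a)) (i := 0) _ _ _ _ _) _ _ => //.
  - move=> a j _ jx; rewrite /S /=; apply/eqP => /(congr1 size); rewrite size_drop /=; lia.
  - by move=> a _; rewrite /S /= drop_size.
  - have H y : pexec (A := par_sub (A := par_loop (A := A) (fun a => size (x a)))
        (fun z => exists w, nth [::] (S z.1 z.2) 0 = y :: w))
      (Seq (Pop 0) (Seq (Push 3 y) (Push 4 true)))
      (fun z => S z.1 z.2) (fun z => S z.1 z.2.+1).
      apply: pexec_seq; first exact: pexec_pop.
      apply: pexec_seq; first exact: pexec_push.
      apply: pexec_post; first exact: pexec_push.
      move=> [a j] [[/= oka jx] [w]] Ew.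
      have Ed : drop j.+1 (x a) = w by rewrite -add1n -drop_drop Ew /= drop0.
      rewrite /S Ed Ew (take_nth false) // rev_rcons /=.
      by rewrite -[j in nth _ _ j]addn0 -nth_drop Ew.
    apply: pexec_case => //.
    have [p _] := mb; exists 0%R => prog -[a j] [[/= oka jx] Ed].
    by move/(congr1 size): Ed; rewrite size_drop /=; lia.
  - by move=> a _; rewrite /S drop0 take0.
  - by move=> a _; rewrite /S drop_size take_size.
pose S a j := regs (rev (take j (rev (x a)))) [::] [::] (drop j (rev (x a))) (unary (size (x a))) [::] [::] [::].
apply: pexec_eq (pexec_while (S := S) (m := fun a => size (x a)) (i := 3) _ _ _ _ _) _ _ => //.
- move=> a j _ jx; rewrite /S /=; apply/eqP => /(congr1 size); rewrite size_drop size_rev /=; lia.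
- by move=> a _; rewrite /S /= -(size_rev (x a)) drop_size.
- have H y : pexec (A := par_sub (A := par_loop (A := A) (fun a => size (x a)))
      (fun z => exists w, nth [::] (S z.1 z.2) 3 = y :: w))
    (Seq (Pop 3) (Push 0 y)) (fun z => S z.1 z.2) (fun z => S z.1 z.2.+1).
    apply: pexec_seq; first exact: pexec_pop.
    apply: pexec_post; first exact: pexec_push.
    move=> [a j] [[/= oka jx] [w]] Ew.
    have Ed : drop j.+1 (rev (x a)) = w by rewrite -add1n -drop_drop Ew /= drop0.
    rewrite /S Ed Ew (take_nth false) ?size_rev // rev_rcons /=.
    by rewrite -[j in nth _ _ j]addn0 -nth_drop Ew.
  apply: pexec_case => //.
  have [p _] := mb; exists 0%R => prog -[a j] [[/= oka jx] Ed].
  by move/(congr1 size): Ed; rewrite size_drop size_rev /=; lia.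
- by move=> a _; rewrite /S drop0 take0.
- by move=> a _; rewrite /S -(size_rev (x a)) drop_size take_size revK.
Qed.

(** The counter is popped before it is emitted, so the names are written in descending order and
    read in ascending order. *)
Definition EmitConsts : cmd := Loop 5 (Seq (Push 1 false) (Seq (EmitReg 5) (Push 1 true))).

Lemma pexec_consts (A : param) (m : A -> nat) (i o n b d : A -> word) : poly_bounded m ->
  pexec EmitConsts
    (fun a => regs (i a) (o a) [::] [::] (n a) (unary (m a)) (b a) (d a))
    (fun a => regs (i a) (flatten [seq true :: enc_name c | c <- consts (m a)] ++ o a) [::] [::] (n a) [::] (b a) (d a)).
Proof.
move=> mb.
pose S a j := regs (i a) (flatten [seq true :: enc_name (cname v) | v <- iota (m a - j) j] ++ o a) [::] [::] (n a)
  (unary (m a - j)) (b a) (d a).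
apply: pexec_eq (pexec_loop (S := S) (m := m) (i := 5) _ _ _ _) _ _ => //.
- apply: pexec_seq; first exact: pexec_push.
  rewrite /=; apply: pexec_seq.
    apply: (pexec_emit_reg (A := par_loop m) (r := 5) (v := fun z => m z.1 - z.2.+1)
      (L := fun z x y w => regs (i z.1) x y [::] (n z.1) w (b z.1) (d z.1))) => //.
    by apply: poly_boundedW (poly_bounded_loop m mb) => -[a j] _; exact: leq_subr.
  apply: pexec_post; first exact: pexec_push.
  move=> [a j] [/= oka jm]; rewrite /S /= subnSK //.
  by rewrite enc_cname -!catA.
- by move=> a _; rewrite /S subn0.
- by move=> a _; rewrite /S subnn /consts -map_comp.
Qed.

Definition EmitUnary : cmd := Seq (Push 1 false) (Loop 5 (Push 1 true)).

Lemma pexec_emit_unary (A : param) (m : A -> nat) (i o n b d : A -> word) : poly_bounded m ->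
  pexec EmitUnary
    (fun a => regs (i a) (o a) [::] [::] (n a) (unary (m a)) (b a) (d a))
    (fun a => regs (i a) (enc_nat (m a) ++ o a) [::] [::] (n a) [::] (b a) (d a)).
Proof.
move=> mb; apply: pexec_seq; first exact: pexec_push.
rewrite /=; apply: pexec_post.
  exact: (pexec_move (r := 5) (s := 1) (L := fun a x y => regs (i a) y [::] [::] (n a) x (b a) (d a))).
by move=> a _; rewrite /enc_nat -cats1 -catA.
Qed.

(** * The reduction *)

Section Query.
Variables (V : tm 1) (pT pq : {poly nat}).
Notation l := (code_size V).

Definition witness_size (n : nat) : nat := horner pq n.
(** Evaluated at the length of [pair_words x y]. *)
Definition time_bound (n : nat) : nat := horner pT (2 * n + 2 + witness_size n).
Definition row_size (n : nat) : nat :=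
  margin (time_bound n) + (2 * n + 2 + witness_size n) + time_bound n + 5.
Definition step_count (n : nat) : nat := (time_bound n).+2 * row_size n.
Definition shift (n : nat) : nat := (row_size n).+1 * l.
Definition var_count (n : nat) : nat := ((row_size n).+1 + step_count n) * l.

(** An equality and not a bound, since [Horner] has to produce the value itself. *)
Definition polynomial (f : nat -> nat) : Prop := exists p : {poly nat}, forall n, horner p n = f n.

Lemma polynomial_cst c : polynomial (fun=> c).
Proof. by exists (polyC c) => n; rewrite hornerC. Qed.
Lemma polynomial_id : polynomial id.
Proof. by exists (polyX _) => n; rewrite hornerX. Qed.
Lemma polynomialD f g : polynomial f -> polynomial g -> polynomial (fun n => f n + g n).
Proof. by move=> [p pf] [q qg]; exists (p + q)%R => n; rewrite hornerD pf qg. Qed.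
Lemma polynomialM f g : polynomial f -> polynomial g -> polynomial (fun n => f n * g n).
Proof. by move=> [p pf] [q qg]; exists (p * q)%R => n; rewrite hornerM pf qg. Qed.
Lemma polynomial_ext f g : f =1 g -> polynomial f -> polynomial g.
Proof. by move=> fg [p pf]; exists p => n; rewrite pf fg. Qed.
Lemma polynomialS f : polynomial f -> polynomial (fun n => (f n).+1).
Proof.
move=> pf; apply: polynomial_ext (polynomialD pf (polynomial_cst 1)) => n.
by rewrite addn1.
Qed.
Lemma polynomial_horner (p : {poly nat}) f : polynomial f -> polynomial (fun n => horner p (f n)).
Proof.
move=> pf; rewrite /horner; elim: (p : seq nat) => [|c s IH] /=; first exact: polynomial_cst.
by apply: polynomialD (polynomial_cst c); apply: polynomialM.
Qed.

Lemma polynomial_bounded (A : param) f (m : A -> nat) : polynomial f -> poly_bounded m ->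
  poly_bounded (fun a => f (m a)).
Proof.
move=> [p pf] mb; apply: poly_boundedW (poly_bounded_horner p mb) => a _.
by rewrite pf.
Qed.

Lemma polynomial_witness_size : polynomial witness_size.
Proof. by exists pq. Qed.
Lemma polynomial_time_bound : polynomial time_bound.
Proof.
apply: polynomial_horner; apply: polynomialD polynomial_witness_size.
apply: polynomialD (polynomial_cst 2); apply: polynomialM polynomial_id; exact: polynomial_cst.
Qed.
Lemma polynomial_margin : polynomial (fun n => margin (time_bound n)).
Proof. exact/polynomialS/polynomialS/polynomial_time_bound. Qed.
Lemma polynomial_row_size : polynomial row_size.
Proof.
apply: polynomialD (polynomial_cst 5); apply: polynomialD polynomial_time_bound.
apply: polynomialD polynomial_margin _; apply: polynomialD polynomial_witness_size.
apply: polynomialD (polynomial_cst 2); apply: polynomialM polynomial_id; exact: polynomial_cst.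
Qed.
Lemma polynomial_step_count : polynomial step_count.
Proof. exact: polynomialM polynomial_margin polynomial_row_size. Qed.
Lemma polynomial_shift : polynomial shift.
Proof. exact: polynomialM (polynomialS polynomial_row_size) (polynomial_cst l). Qed.
Lemma polynomial_var_count : polynomial var_count.
Proof.
apply: polynomialM (polynomial_cst l).
exact: polynomialD (polynomialS polynomial_row_size) polynomial_step_count.
Qed.

Definition query_dnf (x : word) : seq (seq literal) :=
  tableau_dnf V x (witness_size (size x)) (time_bound (size x)) (step_count (size x)).

(** The input is written from its end: precision, goal, step constraints, row constraints,
    constants, individuals, with the end marks of the lists in between. [Clear 6] is needed because
    step and row blocks both start at base 0. *)
Definition Query (pm pN pD pR pK pk : {poly nat}) : cmd :=
  Seq Measure
  (Seq (Horner pk) (Seq EmitUnary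
  (Seq (PushWord 1 enc_goal)
  (Seq (Push 1 false)
  (Seq (Horner pD) (Seq (Loop 5 (Push 7 true))
  (Seq (Horner pN) (Seq (Loop 5 (Block l (step_block V)))
  (Seq (Clear 6)
  (Seq (Horner pm) (Seq (Loop 5 (Block l (cell_block (blank V))))
  (Seq (Block l (cell_block (pre_cell V)))
  (Seq (EmitInput V)
  (Seq (Block l (cell_block (bit_cell V false)))
  (Seq (Block l (cell_block (bit_cell V true)))
  (Seq (Horner pq) (Seq (Loop 5 (Block l (free_block V)))
  (Seq (Horner pR) (Seq (Loop 5 (Block l (cell_block (blank V))))
  (Seq (Push 1 false)
  (Seq (Horner pK) (Seq EmitConsts
  (PushWord 1 (enc_seq enc_name [:: [::]])))))))))))))))))))))))).

Lemma instances_cons D b B s F :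
  instances V D b (B :: s) F = instances V D (b + l) s ([seq inst b D tm | tm <- B] ++ F).
Proof. by []. Qed.

Lemma instances_row D L R q x F (b := 0 + L * l) (b' := b + l + (size x).*2 * l) :
  instances V D 0 (row_blocks V L R q x) F =
  instances V D (b' + l + l + q * l) (nseq R (cell_block (blank V)))
    (instances V D (b' + l + l) (nseq q (free_block V))
      ([seq inst (b' + l) D tm | tm <- cell_block (bit_cell V true)] ++
       [seq inst b' D tm | tm <- cell_block (bit_cell V false)] ++
       instances V D (b + l) (input_blocks V x)
         ([seq inst b D tm | tm <- cell_block (pre_cell V)] ++
          instances V D 0 (nseq L (cell_block (blank V))) F))).
Proof.
rewrite /row_blocks /pre_blocks -!catA cat_cons -!catA -/(input_blocks V x).
rewrite instances_cat size_nseq instances_cons instances_cat size_input_blocks.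
by rewrite !cat_cons cat0s !instances_cons instances_cat size_nseq.
Qed.

Lemma enc_termsE CD F :
  flatten [seq true :: (enc_assertion p.1 ++ enc_annotation p.2) | p <- [seq (goal CD, ann t) | t <- F]]
  = enc_terms F.
Proof.
rewrite /enc_terms -map_comp; congr flatten; apply: eq_map => t.
by rewrite /= /enc_annotation /enc_seq /ann -map_comp.
Qed.

Lemma enc_dnf_input CD K F k : enc_input (dnf_input CD K F) ++ enc_nat k =
  enc_seq enc_name [:: [::]] ++ flatten [seq true :: enc_name c | c <- consts K] ++
  false :: enc_terms F ++ false :: enc_goal ++ enc_nat k.
Proof.
rewrite -(enc_termsE CD) /enc_input [enc_seq enc_name (consts K)]/enc_seq.
by rewrite [X in _ ++ _ ++ X ++ _]/enc_seq -!catA.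
Qed.

Lemma pexec_query CD (A : param) (x : A -> word) (pm pN pD pR pK pk : {poly nat}) :
  poly_bounded (fun a => size (x a)) ->
  (forall n, horner pm n = margin (time_bound n)) ->
  (forall n, horner pN n = step_count n) ->
  (forall n, horner pD n = shift n) ->
  (forall n, horner pR n = time_bound n + 5) ->
  (forall n, horner pK n = var_count n) ->
  (forall n, horner pk n = var_count n + 2) ->
  exists b d : A -> nat, pexec (Query pm pN pD pR pK pk)
    (fun a => regs (x a) [::] [::] [::] [::] [::] [::] [::])
    (fun a => regs [::] (enc_input (dnf_input CD (var_count (size (x a))) (query_dnf (x a))) ++
        enc_nat (var_count (size (x a)) + 2)) [::] [::] (unary (size (x a))) [::] (unary (b a)) (unary (d a))).
Proof.
move=> xb Em EN ED ER EK Ek; pose n a := size (x a).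
have Bm : poly_bounded (fun a => horner pm (n a)) by exact: poly_bounded_horner.
have BN : poly_bounded (fun a => horner pN (n a)) by exact: poly_bounded_horner.
have BD : poly_bounded (fun a => horner pD (n a)) by exact: poly_bounded_horner.
have BR : poly_bounded (fun a => horner pR (n a)) by exact: poly_bounded_horner.
have BK : poly_bounded (fun a => horner pK (n a)) by exact: poly_bounded_horner.
have Bk : poly_bounded (fun a => horner pk (n a)) by exact: poly_bounded_horner.
have Bq : poly_bounded (fun a => horner pq (n a)) by exact: poly_bounded_horner.
have B0 : poly_bounded (A := A) (fun=> 0) by exact: poly_bounded_cst.
(* [b1] to [b7] follow the base register through the stages after its reset; the sums keep the form
   that the block rules produce. *)
pose b1 a := 0 + horner pm (n a) * l.
have Bb1 : poly_bounded b1.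
  by apply: poly_boundedD B0 _; apply: poly_boundedM Bm (poly_bounded_cst _ l).
pose b2 a := b1 a + l.
have Bb2 : poly_bounded b2 by apply: poly_boundedD Bb1 (poly_bounded_cst _ l).
pose b3 a := b2 a + (n a).*2 * l.
have Bb3 : poly_bounded b3.
  apply: poly_boundedD Bb2 _; apply: poly_boundedM _ (poly_bounded_cst _ l).
  by apply: poly_boundedW (poly_boundedD xb xb) => a _; rewrite -addnn.
pose b4 a := b3 a + l.
have Bb4 : poly_bounded b4 by apply: poly_boundedD Bb3 (poly_bounded_cst _ l).
pose b5 a := b4 a + l.
have Bb5 : poly_bounded b5 by apply: poly_boundedD Bb4 (poly_bounded_cst _ l).
pose b6 a := b5 a + horner pq (n a) * l.
have Bb6 : poly_bounded b6.
  by apply: poly_boundedD Bb5 _; apply: poly_boundedM Bq (poly_bounded_cst _ l).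
pose b7 a := b6 a + horner pR (n a) * l.
exists b7, (fun a => horner pD (n a)).
pose target a := enc_input (dnf_input CD (var_count (n a)) (query_dnf (x a))) ++ enc_nat (var_count (n a) + 2).
rewrite -[X in pexec _ _ X]/(fun a => regs [::] (target a) [::] [::] (unary (n a)) [::] (unary (b7 a)) (unary (horner pD (n a)))).
pose F0 a := instances V (horner pD (n a)) 0 (nseq (horner pN (n a)) (step_block V)) [::].
pose o a := false :: enc_goal ++ enc_nat (horner pk (n a)).
pose st F b := fun a : A => regs (x a) (enc_terms (F a) ++ o a) [::] [::] (unary (n a)) [::] (unary (b a)) (unary (horner pD (n a))).
apply: (pexec_seq (S1 := fun a => regs (x a) [::] [::] [::] (unary (n a)) [::] (unary 0) (unary 0))).
  exact: pexec_measure.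
apply: pexec_seq; first exact: pexec_horner.
apply: pexec_seq; first exact: pexec_emit_unary.
apply: pexec_seq; first exact: pexec_push_word.
apply: pexec_seq; first exact: pexec_push.
rewrite /=.
apply: pexec_seq; first exact: pexec_horner.
apply: (pexec_seq (S1 := st (fun=> [::]) (fun=> 0))).
  apply: pexec_post.
    apply: (pexec_move (r := 5) (s := 7) (L := fun a w y => regs (x a) (false :: enc_goal ++ enc_nat (horner pk (n a)) ++ [::])
      [::] [::] (unary (n a)) w (unary 0) y) (v := fun a => horner pD (n a))) => //.
  by move=> a _; rewrite /st /o !cats0.
apply: pexec_seq; first exact: pexec_horner.
apply: pexec_seq; first exact: (@pexec_blocks V A _ (fun=> 0) _ _ _ B0 BD _ _ _ BN).
apply: (pexec_seq (S1 := st F0 (fun=> 0))).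
  apply: (pexec_clear (r := 6) (L := fun a w => regs (x a) (enc_terms (F0 a) ++ o a) [::] [::] (unary (n a)) [::] w
    (unary (horner pD (n a)))) (v := fun a => 0 + horner pN (n a) * l)) => //.
  by apply: poly_boundedD B0 _; apply: poly_boundedM BN (poly_bounded_cst _ l).
apply: pexec_seq; first exact: pexec_horner.
apply: pexec_seq; first exact: (@pexec_blocks V A _ (fun=> 0) _ _ _ B0 BD _ _ _ Bm).
apply: pexec_seq; first exact: (@pexec_block A _ _ _ b1 _ Bb1 BD).
apply: pexec_seq; first exact: (@pexec_input V A _ b2 _ _ _ Bb2 BD).
apply: pexec_seq; first exact: (@pexec_block A _ _ _ b3 _ Bb3 BD).
apply: pexec_seq; first exact: (@pexec_block A _ _ _ b4 _ Bb4 BD).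
apply: pexec_seq; first exact: pexec_horner.
apply: pexec_seq; first exact: (@pexec_blocks V A _ b5 _ _ _ Bb5 BD _ _ _ Bq).
apply: pexec_seq; first exact: pexec_horner.
apply: pexec_seq; first exact: (@pexec_blocks V A _ b6 _ _ _ Bb6 BD _ _ _ BR).
apply: pexec_seq; first exact: pexec_push.
apply: pexec_seq; first exact: pexec_horner.
apply: pexec_seq; first exact: pexec_consts.
apply: pexec_post; first exact: pexec_push_word.
move=> a _; rewrite /target enc_dnf_input /query_dnf /tableau_dnf instances_row.
rewrite /b7 /b6 /b5 /b4 /b3 /b2 /b1 /F0 /o /n !Em !EN !ED !ER !EK !Ek.
by [].
Qed.
End Query.

(** * Rounding the answer *)

(* Little-endian; the final carry is dropped. *)
Fixpoint increment (c : bool) (s : word) : word :=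
  if s is b :: s' then (b (+) c) :: increment (b && c) s' else [::].

Lemma size_increment c s : size (increment c s) = size s.
Proof. by elim: s c => //= b s IH c; rewrite IH. Qed.

Lemma nth_increment c s j : j < size s ->
  nth false (increment c s) j = nth false s j (+) (c && all id (take j s)).
Proof.
elim: s c j => // b s IH c [|j] js; first by rewrite take0 andbT.
by rewrite /= IH // andbA [b && c]andbC.
Qed.

Definition value (s : word) : nat := foldr (fun (b : bool) n => n.*2 + b) 0 s.

Lemma nat_of_word_rev s : nat_of_word (rev s) = value s.
Proof. by rewrite /nat_of_word foldl_rev. Qed.

Lemma value_negb s : value [seq ~~ b | b <- s] + value s + 1 = 2 ^ size s.
Proof. by elim: s => //= b s IH; rewrite expnS -IH; case: b; lia. Qed.

Lemma value_increment c s : value (increment c s) + 2 ^ size s * (c && all id s) = value s + c.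
Proof.
elim: s c => [|b s IH] c /=; first by rewrite andbT mul1n.
have := IH (b && c); rewrite expnS; clear IH; case: b; case: c => /=; lia.
Qed.

Lemma value_rcons s b : value (rcons s b) = value s + 2 ^ size s * b.
Proof. by elim: s => [|x s IH] /=; rewrite ?expnS ?IH; clear; case: b; lia. Qed.

Lemma value_lt s : value s < 2 ^ size s.
Proof. by elim: s => //= b s IH; rewrite expnS; case: b; lia. Qed.

(** Adding 2 and dividing by 4 amounts to dropping the two low bits and adding the upper one of them
    as a carry. *)
Definition decode_answer (y : word) : word :=
  let r := rev [seq ~~ b | b <- y] in behead (rev (increment (nth false r 1) (drop 2 r))).

(* If m is 4 * (2 ^ K - f) up to an error of 1, then (2 ^ (K + 3) - 1 - m + 2) / 4 is
   2 ^ K + f; the leading bit of that numeral is removed. *)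
Lemma decode_answerP K f y : size y = K.+3 -> f < 2 ^ K ->
  4 * 2 ^ K <= nat_of_word y + 4 * f + 1 -> nat_of_word y + 4 * f <= 4 * 2 ^ K + 1 ->
  nat_of_word (decode_answer y) = f.
Proof.
move=> sy fK lo hi; rewrite /decode_answer /=.
have Ny : nat_of_word y = value (rev y) by rewrite -nat_of_word_rev revK.
have Er : rev [seq ~~ b | b <- y] = [seq ~~ b | b <- rev y] by rewrite map_rev.
have := value_negb (rev y); rewrite -Ny size_rev sy -Er.
have : size (rev [seq ~~ b | b <- y]) = K.+3 by rewrite size_rev size_map.
case: (rev _) => [//|b0 [//|c s]] [sS] /=; rewrite drop0.
have si : size (increment c s) = K.+1 by rewrite size_increment.
have := value_increment c s; have := value_lt (increment c s); rewrite si sS.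
case: (lastP (increment c s)) si => [//|t h]; rewrite size_rcons => -[st].
rewrite rev_rcons /= nat_of_word_rev value_rcons st !expnS.
have := value_lt t; rewrite st; move: (value t) (2 ^ K) fK lo hi => v k fK lo hi.
by case: b0; case: c; case: h; case: (all _ _) => /=; lia.
Qed.

(** Register 5 holds the carry in unary, so the [false] branches on it are never taken. Pushing the
    bits on register 0 puts the most significant one on top, where the last [Pop] removes it. *)
Definition Decode : cmd :=
  Seq (While 1 (Case 1 Skip (Seq (Pop 1) (Push 2 true)) (Seq (Pop 1) (Push 2 false))))
  (Seq (Pop 2) (Seq (Case 2 Skip Skip (Push 5 true)) (Seq (Pop 2)
  (Seq (While 2 (Case 2 Skip
     (Seq (Pop 2) (Case 5 (Push 0 false) Skip (Seq (Pop 5) (Push 0 true))))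
     (Seq (Pop 2) (Case 5 (Push 0 true) Skip (Push 0 false)))))
  (Pop 0))))).

Lemma pexec_absurd (A : param) c (S S' : A -> store) : (forall a : A, par_ok a -> False) -> pexec c S S'.
Proof. by move=> H; exists 0%R => prog a /H. Qed.

Lemma pexec_decode (A : param) (y n b d : A -> word) :
  poly_bounded (fun a => size (y a)) -> (forall a : A, par_ok a -> 1 < size (y a)) ->
  exists c, pexec Decode
    (fun a => regs [::] (y a) [::] [::] (n a) [::] (b a) (d a))
    (fun a => regs (decode_answer (y a)) [::] [::] [::] (n a) (c a) (b a) (d a)).
Proof.
move=> yb y2; pose r a := rev [seq ~~ b | b <- y a].
pose c a := nth false (r a) 1; pose s a := drop 2 (r a).
have sr a : size (r a) = size (y a) by rewrite size_rev size_map.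
have ss a : size (s a) = size (y a) - 2 by rewrite size_drop sr.
have sb : poly_bounded (fun a => size (s a)).
  by apply: poly_boundedW yb => a _; rewrite ss leq_subr.
exists (fun a => nseq (c a && all id (s a)) true).
apply: (pexec_seq (S1 := fun a => regs [::] [::] (r a) [::] (n a) [::] (b a) (d a))).
  pose S a j := regs [::] (drop j (y a)) (rev [seq ~~ b | b <- take j (y a)]) [::] (n a) [::] (b a) (d a).
  apply: pexec_eq (pexec_while (S := S) (m := fun a => size (y a)) (i := 1) _ _ _ _ _) _ _ => //.
  - move=> a j _ jx; rewrite /S /=; apply/eqP => /(congr1 size); rewrite size_drop /=; lia.
  - by move=> a _; rewrite /S /= drop_size.
  - have H x : pexec (A := par_sub (A := par_loop (A := A) (fun a => size (y a)))
        (fun z => exists w, nth [::] (S z.1 z.2) 1 = x :: w))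
      (Seq (Pop 1) (Push 2 (~~ x))) (fun z => S z.1 z.2) (fun z => S z.1 z.2.+1).
      apply: pexec_seq; first exact: pexec_pop.
      apply: pexec_post; first exact: pexec_push.
      move=> [a j] [[/= oka jx] [w]] Ew.
      have Ed : drop j.+1 (y a) = w by rewrite -add1n -drop_drop Ew /= drop0.
      rewrite /S Ed Ew (take_nth false) // map_rcons rev_rcons /=.
      by rewrite -[j in nth _ _ j]addn0 -nth_drop Ew.
    apply: pexec_case; [by []| |exact: (H false)|exact: (H true)].
    apply: pexec_absurd => -[a j] [[/= oka jx] Ed].
    by move/(congr1 size): Ed; rewrite size_drop /=; lia.
  - by move=> a _; rewrite /S drop0 take0.
  - by move=> a _; rewrite /S drop_size take_size.
apply: pexec_seq; first exact: pexec_pop.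
rewrite /=; apply: (pexec_seq (S1 := fun a => regs [::] [::] (behead (r a)) [::] (n a) (nseq (c a) true) (b a) (d a))).
  have Er (a : A) : par_ok a -> exists x w, behead (r a) = x :: w /\ c a = x.
    move=> oka; have := y2 a oka; rewrite -sr /c.
    by case: (r a) => [//|x [//|x' w]] _; exists x', w.
  apply: pexec_case => //.
  - by apply: pexec_absurd => a [/= /Er[x [w [-> _]]]].
  - apply: pexec_post (pexec_skip _) _ => a [oka [w /= Ew]].
    by have [x [w' [Ew' ->]]] := Er a oka; move: Ew; rewrite Ew' => -[->].
  - apply: pexec_post; first exact: pexec_push.
    move=> a [oka [w /= Ew]].
    by have [x [w' [Ew' ->]]] := Er a oka; move: Ew; rewrite Ew' => -[->].
apply: pexec_seq; first exact: pexec_pop.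
(* The carry into bit [j]: it survives as long as all lower bits are set. *)
pose carry a j := c a && all id (take j (s a)).
pose S a j := regs (rev (take j (increment (c a) (s a)))) [::] (drop j (s a)) [::] (n a) (nseq (carry a j) true) (b a) (d a).
apply: (pexec_seq (S1 := fun a => S a (size (s a)))).
  apply: pexec_eq (pexec_while (S := S) (m := fun a => size (s a)) (i := 2) _ _ _ _ _) _ _ => //.
  - move=> a j _ jx; rewrite /S /=; apply/eqP => /(congr1 size); rewrite size_drop /=; lia.
  - by move=> a _; rewrite /S /= drop_size.
  - have E x a j w : j < size (s a) -> drop j (s a) = x :: w ->
       S a j.+1 = regs (x (+) carry a j :: rev (take j (increment (c a) (s a)))) [::] w [::] (n a)
         (nseq (carry a j && x) true) (b a) (d a).
      move=> js Ew.
      have Ex : nth false (s a) j = x by rewrite -[j in nth _ _ j]addn0 -nth_drop Ew.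
      have Ed : drop j.+1 (s a) = w by rewrite -add1n -drop_drop Ew /= drop0.
      rewrite /S Ed (take_nth false) ?size_increment // rev_rcons nth_increment // Ex.
      by rewrite /carry (take_nth false) // all_rcons /= Ex [x && _]andbC andbA.
    apply: pexec_case => //.
    + apply: pexec_absurd => -[a j] [[/= oka jx] Ed].
      by move/(congr1 size): Ed; rewrite size_drop /=; lia.
    + apply: pexec_seq; first exact: pexec_pop.
      apply: pexec_case => //.
      * apply: pexec_post; first exact: pexec_push.
        move=> [a j] [[[/= oka js] [w Ew]]]; rewrite (E false a j w) // Ew /=.
        by case: (carry a j).
      * apply: pexec_absurd => -[a j] [_ [w]] /=.
        by case: (carry a j).
      * apply: pexec_seq; first exact: pexec_pop.
        apply: pexec_post; first exact: pexec_push.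
        move=> [a j] [[[/= oka js] [w Ew]] [w']]; rewrite (E false a j w) // Ew /=.
        by case: (carry a j).
    + apply: pexec_seq; first exact: pexec_pop.
      apply: pexec_case => //.
      * apply: pexec_post; first exact: pexec_push.
        move=> [a j] [[[/= oka js] [w Ew]]]; rewrite (E true a j w) // Ew /=.
        by case: (carry a j).
      * apply: pexec_absurd => -[a j] [_ [w]] /=.
        by case: (carry a j).
      * apply: pexec_post; first exact: pexec_push.
        move=> [a j] [[[/= oka js] [w Ew]] [w']]; rewrite (E true a j w) // Ew /=.
        by case: (carry a j).
  - move=> a _; rewrite /S /carry !take0 drop0 andbT /s.
    by case: (r a) => [|? [|? ?]]; rewrite //= drop0.
apply: pexec_post; first exact: pexec_pop.
move=> a _; rewrite /S /carry /= drop_size take_size -(size_increment (c a)) take_size.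
done.
Qed.

(** Scaling by 2^(K + 2) leaves two integers, [m] and [4 * g], at distance at most 1. *)
Lemma answer_bounds (R : realType) K g m :
  (`|m%:R / 2 ^+ (K + 2) - g%:R / 2 ^+ K| <= 2 ^- (K + 2) :> R)%R ->
  4 * g <= m + 1 /\ m <= 4 * g + 1.
Proof.
have p0 : (0 < 2 ^+ (K + 2) :> R)%R by rewrite exprn_gt0.
have -> : (m%:R / 2 ^+ (K + 2) - g%:R / 2 ^+ K = (m%:R - (4 * g)%:R) / 2 ^+ (K + 2) :> R)%R.
  have n0 : (2 ^+ K != 0 :> R)%R by rewrite expf_neq0 // pnatr_eq0.
  by rewrite natrM exprD; field.
rewrite normrM normfV (gtr0_norm p0) -[leRHS]mul1r ler_pM2r ?invr_gt0 // ler_norml.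
by move=> /andP[]; rewrite lerBrDl !lerBlDr natr1 nat1r !ler_nat; lia.
Qed.

Theorem theorem1 (R : realType) (CD : concrete_domains) :
  exists (T : seq (tbox_axiom CD * annotation)) (M : mln R),
    sharpP_hard (computes_prob T M).
Proof.
exists [::], (uniform_mln R) => f [V [pT [pq [haltV fE]]]].
have [pm Em] := polynomial_margin pT pq.
have [pN EN] := polynomial_step_count pT pq.
have [pD ED] := polynomial_shift V pT pq.
have [pR ER] := polynomialD (polynomial_time_bound pT pq) (polynomial_cst 5).
have [pK EK] := polynomial_var_count V pT pq.
have [pk Ek] := polynomialD (polynomial_var_count V pT pq) (polynomial_cst 2).
pose K (x : word) := var_count V pT pq (size x).
pose d x := dnf_input CD (K x) (query_dnf V pT pq x).
(* The oracle is a component of the parameter, so one polynomial serves for all correct oracles. *)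
pose A := @Param ((word -> word) * word) fst (fun a => size a.2)
  (fun a => computes_prob [::] (uniform_mln R) (CD := CD) a.1).
have sizeb : poly_bounded (A := A) (fun a => size a.2) by exists (polyX _) => a _; rewrite hornerX.
have Kb : poly_bounded (A := A) (fun a => K a.2).
  exact: polynomial_bounded (polynomial_var_count V pT pq) sizeb.
have haltT x (y : (witness_size pq (size x)).-tuple bool) :
    halted (@tm_step 1 V) (run (@tm_step 1 V) (time_bound pT pq (size x)) (start_config V (pair_words x y))).
  by have := haltV (pair_words x y); rewrite /halts_within /poly_bound size_pair size_tuple.
have leN (x : word) : (time_bound pT pq (size x)).+2 * row_size pT pq (size x) <= step_count pT pq (size x) by [].
have wf x : wf_dnf (K x) (query_dnf V pT pq x) by exact (tableau_dnf_wf (haltT x) (leN x)).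
have fK x : n_sat (K x) (query_dnf V pT pq x) + f x = 2 ^ K x.
  rewrite -(n_sat_tableau (haltT x) (leN x)) fE; congr (_ + _).
  apply: eq_card => y; rewrite !inE /accepts_within /poly_bound.
  by rewrite size_pair size_tuple.
(* There are fewer witness bits than variables. Strictness ensures that removing the leading bit of
   [2 ^ K + f] leaves [f]. *)
have ltf x : f x < 2 ^ K x.
  apply: (@leq_ltn_trans (2 ^ witness_size pq (size x))).
    rewrite fE; apply: leq_trans (max_card _) _.
    by rewrite card_tuple card_bool.
  rewrite ltn_exp2l //.
  rewrite /K /var_count; apply: (@leq_trans ((row_size pT pq (size x)).+1 + step_count pT pq (size x))).
    by rewrite /row_size; lia.
  by rewrite leq_pmulr.
pose ans (a : A) := a.1 (enc_input (d a.2) ++ enc_nat (K a.2 + 2)).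
have ansP (a : A) : par_ok a -> size (ans a) = (K a.2 + 2).+1 /\
    nat_of_word (decode_answer (ans a)) = f a.2.
  move=> /(_ _ (dnf_valid R CD (wf a.2)) (K a.2 + 2)) [sa].
  rewrite dnf_atom_prob // => /answer_bounds[lo hi]; split => //.
  move: lo hi (fK a.2) (ltf a.2); rewrite -/(ans a) -/(K a.2) => lo hi fK' ltf'.
  apply: (@decode_answerP (K a.2)) => //; first by rewrite sa addn2.
    by rewrite -fK' mulnDr addnAC leq_add2r.
  by rewrite -fK' mulnDr addnAC leq_add2r.
have [b [c Hquery]] := pexec_query CD (A := A) (x := snd) sizeb Em EN ED ER EK Ek.
(* The reply can be read in polynomial time because a correct oracle answers with exactly K + 3
   bits. *)
have ansb : poly_bounded (fun a => size (ans a)).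
  apply: poly_boundedW (poly_boundedD Kb (poly_bounded_cst _ 3)) => a oka.
  by rewrite (ansP a oka).1 -addnS.
have ans2 (a : A) : par_ok a -> 1 < size (ans a) by move=> /ansP[-> _]; rewrite addn2.
have [c' Hdecode] := pexec_decode (fun a : A => unary (size a.2)) (fun a : A => unary (b a))
  (fun a : A => unary (c a)) ansb ans2.
have Hask : pexec (A := A) Ask
    (fun a => regs [::] (enc_input (d a.2) ++ enc_nat (K a.2 + 2)) [::] [::] (unary (size a.2)) [::] (unary (b a)) (unary (c a)))
    (fun a => regs [::] (ans a) [::] [::] (unary (size a.2)) [::] (unary (b a)) (unary (c a))).
  exact: pexec_ask.
have [p H] := pexec_seq Hquery (pexec_seq Hask Hdecode).
(* Six tapes besides the input and oracle tapes make up the eight registers; the query is built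
   directly on the oracle tape, register 1. *)
exists (machine 6 (Seq (Query V pq pm pN pD pR pK pk) (Seq Ask Decode))), p => O OP x.
apply: exec_computes (H _ (O, x) OP) _; first by case=> [|[|[|[|[|[|[|[|[|?]]]]]]]]].
by rewrite /= (ansP (O, x) OP).2.
Qed.
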